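(* Let $K\subset\mathbb{C}$ be an $E(k,d,\Delta,\kappa,\xi,\delta)$-domain. Then there exists a constant $c_K>0$, depending only (and explicitly) on the parameters $k,d,\Delta,\kappa,\xi,\delta$, such that for every real $q\ge 1$, every $n\in\mathbb{N}$ and every $p\in\mathcal{P}_n(K)$ we have $$\|p'\|_q\ \ge\ c_K\, n\,\|p\|_q .$$
   Context: Here $\mathbb{N}=\{1,2,\dots\}$. For $K\subset\mathbb{C}$, $\mathcal{P}_n(K)$ denotes the set of complex algebraic polynomials of degree exactly $n$ all of whose $n$ complex zeros lie in $K$. For a compact convex set $K$ with boundary $\partial K$ and $0<q<\infty$, $\|f\|_q:=\left(\int_{\partial K}|f(z)|^q\,|dz|\right)^{1/q}$, where $|dz|$ is arc length measure. Boundary curve. Let $K\subset\mathbb{C}$ be a compact convex domain, i.e. a compact convex set with nonempty interior. Its boundary $\Gamma=\partial K$ is a closed convex Jordan curve of finite length $L$. It is parametrized by arc length counterclockwise by $\gamma:[0,L]\to\Gamma$, extended $L$-periodically to $\mathbb{R}$. The derivative satisfies $|\dot\gamma|=1$ wherever it exists (almost everywhere). Let $\alpha=\arg\dot\gamma$ be the tangent angle function, chosen as a nondecreasing real function defined a.e. on $\mathbb{R}$ (with $\alpha(t)-\frac{2\pi}{L}t$ being $L$-periodic), and let $\alpha_-$ and $\alpha_+$ be its left-continuous and right-continuous extensions. For $\zeta=\gamma(\tau)$, $[\alpha_-(\tau),\alpha_+(\tau)]$ is the interval of directions $\beta$ for which $\zeta+e^{i\beta}\mathbb{R}$ is a supporting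 line of $K$ at $\zeta$. The outer (supplementary) angle at $\gamma(\tau)$ is $\Omega(\gamma(\tau)):=\alpha_+(\tau)-\alpha_-(\tau)\ge 0$. By convexity the second derivative $\ddot\gamma$ exists almost everywhere, and $|\ddot\gamma|$ is the curvature. $E$-domain. Let $k\in\mathbb{N}$ and $d,\Delta,\kappa,\xi,\delta>0$ satisfy $0<\Delta\le d/2$, $0<\delta\le\Delta/2$, $0<\xi\le\pi/2$. A compact convex domain $K$ is an $E(k,d,\Delta,\kappa,\xi,\delta)$-domain if: (1) $d$ is the diameter of $K$ and $\Delta$ is the transfinite diameter (logarithmic capacity) of $K$; (2) the boundary curve can be decomposed into $k$ adjoining pieces $\Gamma=\bigcup_{j=1}^k\Gamma_j$, each $\Gamma_j$ being the range of a simple convex Jordan arc $\gamma_j=\gamma|_{I_j}$, $I_j=[v_j,v_{j+1}]$, $j=1,\dots,k$, where $v_1<\dots<v_k$ and $v_{k+1}$ is identified with $v_1$ modulo the period $L$; (3) each $\gamma_j$ belongs to one of the following categories: (i) it satisfies $|\ddot\gamma_j|\ge\kappa$ a.e. on $I_j$ (a curved piece), or (ii) it is a straight line segment of length $L_j=v_{j+1}-v_j\le\Delta-\delta$ (a straight piece); (4) at each $V_j=\gamma(v_j)$, $j=1,\dots,k$, the boundary curve has outer angle $\Omega(V_j)=\alpha_+(v_j)-\alpha_-(v_j)\ge\lambda(j)\,\xi$, where $\lambda(j)\in\{0,1,2\}$ is the number of straight pieces among the two pieces $\Gamma_{j-1}$ and $\Gamma_j$ joining at $V_j$ (with $\Gamma_0:=\Gamma_k$).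 *)

(* Defs.v *)
(* MathComp-Analysis; the real numbers are an arbitrary realType R. *)
From HB Require Import structures.
From mathcomp Require Import all_boot all_order all_algebra.
From mathcomp Require Import complex.
From mathcomp Require Import all_classical all_reals all_analysis.
Set Implicit Arguments.
Unset Strict Implicit.
Unset Printing Implicit Defensive.
Import Order.TTheory GRing.Theory Num.Theory.
Import numFieldNormedType.Exports.
Local Open Scope classical_set_scope.
Local Open Scope ring_scope.

(* The complex plane is [Rcomplex R]: the field R[i] (so that [{poly Rcomplex R}]
   makes sense) with the R-valued modulus as norm.  The instances below give it
   the norm topology and make it a normed R-module, so that derivatives of
   curves R -> Rcomplex R are those of the library. *)
HB.instance Definition _ (R : realType) :=
  PseudoMetric.copy (Rcomplex R) (pseudoMetric_normed (Rcomplex R)).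
HB.instance Definition _ (R : realType) := isPointed.Build (Rcomplex R) 0.
HB.instance Definition _ (R : realType) :=
  NormedZmod_PseudoMetric_eq.Build R (Rcomplex R) erefl.

Lemma Rcomplex_normrZ (R : realType) (a : R) (z : Rcomplex R) :
  `|a *: z| = `|a| * `|z|.
Proof.
case: z => x y.
change (Num.sqrt ((a * x) ^+ 2 + (a * y) ^+ 2)
  = `|a| * Num.sqrt (x ^+ 2 + y ^+ 2)).
by rewrite !exprMn -mulrDr sqrtrM ?sqr_ge0// sqrtr_sqr.
Qed.

HB.instance Definition _ (R : realType) :=
  PseudoMetricNormedZmod_Lmodule_isNormedModule.Build R (Rcomplex R)
    (@Rcomplex_normrZ R).

Definition compact_convex_domain (R : realType) (K : set (Rcomplex R)) : Prop :=
  [/\ compact K, convex_set K & K° !=set0].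

Definition boundary (T : topologicalType) (A : set T) : set T :=
  closure A `\` A°.

Definition diameter (R : realType) (K : set (Rcomplex R)) : R :=
  sup [set `|z.1 - z.2| | z in K `*` K].

Definition nth_diameter (R : realType) (K : set (Rcomplex R)) (n : nat) : R :=
  sup [set (\prod_(i < n) \prod_(j < n | (i < j)%N) `|z i - z j|)
             `^ (2 / (n * n.-1)%:R)
      | z in [set z : 'I_n -> Rcomplex R | forall i, K (z i)]].

Definition is_transfinite_diameter (R : realType) (K : set (Rcomplex R))
    (Delta : R) : Prop :=
  nth_diameter K n @[n --> \oo] --> Delta.

Definition arc_length (R : realType) (g : R -> Rcomplex R) (a b : R) : \bar R :=
  ereal_sup [set (let F := g \o nth b (a :: s) in
                  \sum_(0 <= i < size s) `|F i.+1 - F i|)%:E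
            | s in itv_partition a b].

(* The last clause is the counterclockwise orientation: K lies to the left of
   every tangent. *)
Definition arclength_parametrization (R : realType) (K : set (Rcomplex R))
    (L : R) (g : R -> Rcomplex R) : Prop :=
  [/\ 0 < L,
      forall t, g (t + L) = g t,
      {in `[0, L[ &, injective g} /\ g @` `[0, L[ = boundary K,
      forall a b, a <= b -> arc_length g a b = (b - a)%:E &
      forall t z, derivable g t 1 -> K z ->
        0 <= complex.Im ((z - g t) * conjc (derive1 g t))].

Definition tangent_angle (R : realType) (L : R) (g : R -> Rcomplex R)
    (alpha : R -> R) : Prop :=
  [/\ {homo alpha : s t / s <= t},
      forall t, alpha (t + L) - 2 * pi / L * (t + L)
                = alpha t - 2 * pi / L * t &
      {ae lebesgue_measure, forall t : R,
        is_derive t 1 g (Complex (cos (alpha t)) (sin (alpha t)))}].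

Definition outer_angle (R : realType) (alpha : R -> R) (t : R) : R :=
  lim (alpha s @[s --> t^'+]) - lim (alpha s @[s --> t^'-]).

(* The derivative g' may fail to exist on a countable dense set (corners), so
   the difference quotients of g' range over the points where g' exists. *)
Definition is_second_derivative (R : realType) (g : R -> Rcomplex R) (t : R)
    (w : Rcomplex R) : Prop :=
  derivable g t 1 /\
  h^-1 *: (derive1 g (t + h) - derive1 g t)
    @[h --> within [set h | derivable g (t + h) 1] 0^'] --> w.

Definition curved_piece (R : realType) (kappa : R) (g : R -> Rcomplex R)
    (a b : R) : Prop :=
  {ae lebesgue_measure, forall t : R, t \in `[a, b] ->
    exists2 w, is_second_derivative g t w & kappa <= `|w|}.

Definition straight_piece (R : realType) (maxlen : R) (g : R -> Rcomplex R)
    (a b : R) : Prop :=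
  g @` `[a, b] = [set g a + u *: (g b - g a) | u in `[0, 1]] /\
  b - a <= maxlen.

(* The breakpoints v_1 < ... < v_k of one period are extended to v : nat -> R by
   v_(j + k) = v_j + L, so the pieces I_j = [v_j, v_(j + 1)] are cyclic in j and
   the ones meeting at the vertex v_(j + 1) are I_j and I_(j + 1). *)
Definition E_domain (R : realType) (k : nat) (d Delta kappa xi delta : R)
    (K : set (Rcomplex R)) (L : R) (g : R -> Rcomplex R) (alpha : R -> R)
    : Prop :=
  [/\ diameter K = d,
      is_transfinite_diameter K Delta &
      exists v : nat -> R,
        let straight j := straight_piece (Delta - delta) g (v j) (v j.+1) in
        [/\ forall j, v j < v j.+1,
            forall j, v (j + k)%N = v j + L,
            forall j, curved_piece kappa g (v j) (v j.+1) \/ straight j &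
            forall j, (`[< straight j >] + `[< straight j.+1 >])%N%:R * xi
                      <= outer_angle alpha (v j.+1)]].

Definition polys_zeros_in (R : realType) (n : nat) (K : set (Rcomplex R))
    : set {poly Rcomplex R} :=
  [set p : {poly Rcomplex R} | size p = n.+1 /\ forall z, root p z -> K z].

Definition boundary_norm (R : realType) (L : R) (g : R -> Rcomplex R) (q : R)
    (f : Rcomplex R -> Rcomplex R) : R :=
  (\int[lebesgue_measure]_(t in `[0, L]) (`|f (g t)| `^ q)) `^ q^-1.

(* Main.v *)
Require Import Defs.
From mathcomp Require Import all_boot all_order all_algebra.
From mathcomp Require Import perm cyclic separable cyclotomic.
From mathcomp Require Import complex polyrcf.
From mathcomp Require Import ring lra.
From mathcomp Require Import all_classical all_reals all_analysis.
From mathcomp Require Import measurable_realfun.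
Set Implicit Arguments.
Unset Strict Implicit.
Unset Printing Implicit Defensive.
Import Order.TTheory GRing.Theory Num.Theory.
Import numFieldNormedType.Exports.
Local Open Scope classical_set_scope.
Local Open Scope ring_scope.

(** Let p have its n zeros in K and let zeta be a boundary point with a
    supporting line of direction th.  The imaginary part of
    exp(i th) p'(zeta) / p(zeta) is the sum over the zeros z of
    height(z - zeta) / |z - zeta|^2, where the height is the distance of z to
    that line.  All terms are nonnegative, so |p'(zeta)| >= c n |p(zeta)| as
    soon as a fixed proportion of the zeros contributes at least a constant
    ([log_derivative_ge]).

    If zeta is on a curved piece, every zero contributes: starting from zeta in
    either direction, the tangent turns at rate at least kappa until a straight
    piece begins, and there it turns by xi at once ([forward_turning],
    [backward_turning]), so that K lies inside a circle of controlled radius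
    tangent at zeta ([curved_point]).  If zeta is on a straight piece, of length
    at most Delta - delta and with a corner at each end, the zeros at distance
    more than Delta - delta / 2 from zeta have a height bounded below
    ([short_point]).  When too few zeros are that far, p is small at zeta:
    |p(zeta)| <= |a| rho^n, where a is the leading coefficient and
    rho = Delta - delta / 4 ([derivative_large_or_small]).

    The points of the second kind matter little, because Delta is the
    transfinite diameter.  By [transfinite_diameter_le] the maximum of |p'| over
    K is at least n |a| Delta^(n - 1); it is attained on the boundary
    ([maximum_on_boundary]), and by a Markov inequality ([markov_domain]) |p'|
    keeps half of this value on an arc of length of order n^-3
    ([boundary_integral_ge]).  As n^3 (rho / Delta)^n is bounded
    ([cube_geometric_bounded]), the contribution of these points to the norm of
    p is at most a constant times the norm of p' divided by n.

    The curve is only Lipschitz and its tangent angle only monotone; what is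
    known about them almost everywhere is integrated by [increment_ge_ae].  It
    yields the supporting lines ([support_line]), from which all the geometry
    follows. *)

Local Notation C R := (Rcomplex R).

(** * Increments of functions from almost everywhere local bounds *)

Lemma locally_nondecreasing (R : realType) (phi : R -> R) (a b : R) : a <= b ->
  (forall t, a <= t -> t <= b -> exists2 r : R, 0 < r & forall s u : R,
     a <= s -> u <= b -> t - r < s -> s <= t -> t <= u -> u < t + r ->
     phi s <= phi u) ->
  phi a <= phi b.
Proof.
move=> ab loc.
pose S := [set x | [/\ a <= x, x <= b & phi a <= phi x]].
have Sa : S a by split.
have supS : has_sup S by split; [exists a | exists b => x []].
have sb : sup S <= b by apply: ge_sup; [exists a | move=> x []].
have as_ : a <= sup S by apply: ub_le_sup => //; case: supS.
have [r r0 locr] := loc _ as_ sb.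
have [x [ax xb ax'] sx] := sup_adherent r0 supS.
have xs : x <= sup S by apply: ub_le_sup => //; case: supS.
have key u : sup S <= u -> u <= b -> u < sup S + r -> phi a <= phi u.
  by move=> *; apply: (le_trans ax'); apply: locr.
have [bs|bs] := leP b (sup S + r / 2); first by apply: key => //; lra.
suff : sup S + r / 2 <= sup S by lra.
apply: ub_le_sup; first by case: supS.
split; [lra|lra|].
apply: key; lra.
Qed.

(** A lower bound for the derivative off a null set gives a lower bound for the
    increments, for functions with increments bounded below by [- C * (t - s)]:
    Lipschitz functions, and nondecreasing ones with [C = 0].  The null set is
    covered by an open set [U] of small measure; adding to [f] a multiple of the
    measure of [U] to the left of the variable makes it locally nondecreasing,
    up to a linear term. *)
Lemma increment_ge_ae (R : realType) (f : R -> R) (a b c C : R) (N : set R) :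
  a <= b -> 0 <= C -> (@lebesgue_measure R).-negligible N ->
  (forall s t : R, s <= t -> - C * (t - s) <= f t - f s) ->
  (forall t, a < t -> t < b -> ~ N t -> forall e : R, 0 < e ->
     exists2 r : R, 0 < r & forall s u : R,
     t - r < s -> s <= t -> t <= u -> u < t + r ->
     (c - e) * (u - s) <= f u - f s) ->
  c * (b - a) <= f b - f a.
Proof.
move=> ab C0 negN lowC loc.
have neg1 (x : R) : (@lebesgue_measure R).-negligible [set x].
  by apply/negligibleP; [exact: measurable_set1|exact: lebesgue_measure_set1].
have [A [mA A0 NA]] := negligibleU (negligibleU negN (neg1 a)) (neg1 b).
pose D := C + `|c|.
have D0 : 0 <= D by rewrite addr_ge0.
suff H (e : R) : 0 < e -> (c - e) * (b - a) <= f b - f a + D * e.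
  apply/ler_addgt0Pr => e e0.
  pose e' := e / (b - a + D + 1).
  have p0 : 0 < b - a + D + 1 by lra.
  have e'0 : 0 < e' by rewrite divr_gt0.
  have := H _ e'0.
  have -> : e = e' * (b - a + D + 1) by rewrite /e' divfK// gt_eqF.
  nra.
move=> e0.
have Aoo : (lebesgue_measure A < +oo)%E by rewrite A0 ltry.
have [U [oU AU UA]] := lebesgue_regularity_outer mA Aoo e0.
have mU : measurable U by exact: measurable_realfun.open_measurable.
have U_e : (lebesgue_measure U < e%:E)%E.
  have -> : U = A `|` (U `\` A) by rewrite setDUK.
  apply: (le_lt_trans (measureU2 _ _ _)) => //; first exact: measurableD.
  by rewrite A0 add0e.
have fUx x y : (lebesgue_measure (U `&` `]x, y]%classic) \is a fin_num)%E.
  rewrite ge0_fin_numE//; apply: le_lt_trans (lt_trans U_e (ltry _)).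
  by apply: le_measure => //; rewrite ?inE//; apply: measurableI.
pose m x := fine (lebesgue_measure (U `&` `]a - 1, x]%classic)).
have mD x y : a - 1 <= x -> x <= y ->
    m y - m x = fine (lebesgue_measure (U `&` `]x, y]%classic)).
  move=> ax xy; rewrite /m.
  have -> : U `&` `]a - 1, y]%classic =
      (U `&` `]a - 1, x]%classic) `|` (U `&` `]x, y]%classic).
    rewrite -setIUr; congr (_ `&` _); apply/seteqP; split => z /=.
      rewrite !in_itv/= => /andP[az zy].
      by have [zx|xz] := leP z x; [left|right]; apply/andP.
    by rewrite !in_itv/= => -[/andP[? ?]|/andP[? ?]]; apply/andP; split; lra.
  rewrite measureU//; [|exact: measurableI|exact: measurableI|].
    by rewrite (fineD (fUx _ _) (fUx _ _)) addrAC subrr add0r.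
  apply/seteqP; split => z //= -[[_]]; rewrite !in_itv/= => /andP[? ?] [_].
  by move=> /andP[? ?]; lra.
have mge x y : a - 1 <= x -> x <= y -> 0 <= m y - m x.
  by move=> ? ?; rewrite mD// fine_ge0.
pose phi x := f x - (c - e) * x + D * m x.
have : phi a <= phi b.
  apply: locally_nondecreasing => // t at_ tb.
  have [Ut|nUt] := pselect (U t).
    have /nbhs_ballP[r/= r0 rU] : nbhs t U by apply: open_nbhs_nbhs; split.
    exists r => // s u as_ ub ts st tu ut.
    have := mD s u; rewrite /phi.
    have -> : U `&` `]s, u]%classic = `]s, u]%classic.
      apply/seteqP; split => [z []//|z/= zsu]; split => //; apply: rU.
      move: zsu; rewrite in_itv/= => /andP[? ?].
      rewrite /ball/= ltr_distl; apply/andP; split; lra.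
    rewrite lebesgue_measure_itv/= lte_fin.
    have su : s <= u by lra.
    have -> : fine (if s < u then (u%:E - s%:E)%E else 0%E) = u - s.
      by case: ltP => //= us; lra.
    have := lowC _ _ su; have := ler_norm c; rewrite /D.
    move=> h1 h2 h3.
    have as1 : a - 1 <= s by lra.
    have {h3}/eqP := h3 as1 su; rewrite subr_eq => /eqP ->.
    have : 0 <= (`|c| - c + e) * (u - s) by apply: mulr_ge0; lra.
    lra.
  have at' : a < t.
    rewrite lt_neqAle at_ andbT; apply/eqP => ta; apply: nUt; apply: AU.
    by apply: NA; left; right; rewrite ta.
  have tb' : t < b.
    rewrite lt_neqAle tb andbT; apply/eqP => ta; apply: nUt; apply: AU.
    by apply: NA; right; rewrite ta.
  have [|r r0 H] := loc _ at' tb' _ _ e0.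
    by move=> Nt; apply/nUt/AU/NA; left; left.
  exists r => // s u as_ ub ts st tu ut; rewrite /phi.
  have h1 := H _ _ ts st tu ut.
  have h2 : 0 <= D * (m u - m s) by apply: mulr_ge0 => //; apply: mge; lra.
  lra.
rewrite /phi => h.
have h1 : m b - m a <= e.
  rewrite mD//; last lra.
  rewrite -lee_fin fineK//; apply/ltW/(le_lt_trans _ U_e).
  by apply: le_measure => //; rewrite ?inE//; apply: measurableI.
have : D * (m b - m a) <= D * e by exact: ler_wpM2l.
lra.
Qed.

(** * Polynomials on the unit circle and on a segment *)

Section complex_norm.
Variable R : realType.
Implicit Types x y z : Rcomplex R.

Lemma normRcM x y : `|x * y : Rcomplex R| = `|x| * `|y|.
Proof. exact: Normc.normcM. Qed.

Lemma normRcV x : `|x^-1 : Rcomplex R| = `|x|^-1.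
Proof. exact: Normc.normcV. Qed.

Lemma normRc1 : `|1 : Rcomplex R| = 1.
Proof. exact: Normc.normc1. Qed.

Lemma normRcX x n : `|x ^+ n : Rcomplex R| = `|x| ^+ n.
Proof. by elim: n => [|n IH]; rewrite ?normRc1// !exprS normRcM IH. Qed.

Lemma normRc_prod (I : Type) (r : seq I) (P : pred I) (F : I -> Rcomplex R) :
  `|\prod_(i <- r | P i) F i : Rcomplex R| = \prod_(i <- r | P i) `|F i|.
Proof. exact: (big_morph _ normRcM normRc1). Qed.

Lemma normRc_sqr x : `|x| ^+ 2 = complex.Re x ^+ 2 + complex.Im x ^+ 2.
Proof.
case: x => a b.
change (Num.sqrt (a ^+ 2 + b ^+ 2) ^+ 2 = a ^+ 2 + b ^+ 2).
by rewrite sqr_sqrtr// addr_ge0// sqr_ge0.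
Qed.

Lemma normRc_Re x : `|complex.Re x| <= `|x|.
Proof.
rewrite -(@ler_pXn2r _ 2)// ?nnegrE//.
by rewrite normRc_sqr real_normK ?num_real// lerDl sqr_ge0.
Qed.

Lemma normRc_real (a : R) : `|(a%:C)%C : Rcomplex R| = `|a|.
Proof.
change (Num.sqrt (a ^+ 2 + 0 ^+ 2) = `|a|).
by rewrite expr0n addr0 sqrtr_sqr.
Qed.

Lemma normRc_nat n : `|n%:R : Rcomplex R| = n%:R.
Proof.
have -> : (n%:R : Rcomplex R) = (((n%:R : R)%:C)%C : Rcomplex R).
  exact: (esym (rmorph_nat (@real_complex R) n)).
by rewrite normRc_real normr_nat.
Qed.

Lemma natRc_eq0 n : (n%:R == 0 :> Rcomplex R) = (n == 0)%N.
Proof. by rewrite -normr_eq0 normRc_nat pnatr_eq0. Qed.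

Lemma Rc_scale (a : R) x : a *: x = ((a%:C)%C : Rcomplex R) * x.
Proof.
case: x => b c; apply/eqP; rewrite eq_complex/=.
by rewrite !mul0r subr0 addr0 !eqxx.
Qed.

Lemma prim_root_exists n : (0 < n)%N ->
  {z : Rcomplex R | n.-primitive_root z}.
Proof.
pose p : {poly Rcomplex R} := 'X^n - 1.
have [r Dp] := closed_field_poly_normal p.
move=> n_gt0; apply/sigW; rewrite (monicP _) ?monicXnsubC // scale1r in Dp.
have rn1 : all n.-unity_root r.
  by apply/allP=> z; rewrite -root_prod_XsubC -Dp.
have sz_r : (n < (size r).+1)%N.
  by rewrite -(size_prod_XsubC r id) -Dp size_XnsubC.
have [|z] := hasP (has_prim_root n_gt0 rn1 _ sz_r); last by exists z.
by rewrite -separable_prod_XsubC -Dp separable_Xn_sub_1 // natRc_eq0 -lt0n.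
Qed.

Lemma prim_root_norm n z : (0 < n)%N -> n.-primitive_root z -> `|z| = 1.
Proof.
move=> n0 /prim_expr_order zn; apply/eqP.
by rewrite -(@pexpr_eq1 _ _ n)// -normRcX zn normRc1.
Qed.

End complex_norm.

(** Discrete orthogonality of the powers of a root of unity. *)
Lemma sum_prim_root (F : fieldType) (w : F) (N k : nat) :
  N.-primitive_root w ->
  \sum_(i < N) w ^+ (i * k) = if (N %| k)%N then N%:R else 0.
Proof.
move=> pw; have -> : \sum_(i < N) w ^+ (i * k) = \sum_(i < N) (w ^+ k) ^+ i.
  by apply: eq_bigr => i _; rewrite mulnC exprM.
rewrite (prim_order_dvd pw); case: eqP => [->|/eqP wk1].
  by rewrite (eq_bigr (fun=> 1)) ?sumr_const ?card_ord// => i _; rewrite expr1n.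
apply/eqP; have /eqP := subrX1 (w ^+ k) N.
rewrite exprAC (prim_expr_order pw) expr1n subrr eq_sym mulf_eq0 subr_eq0.
by rewrite (negbTE wk1).
Qed.

(** The coefficients of a polynomial as a discrete Fourier transform. *)
Lemma coef_prim_root (F : fieldType) (w : F) (N j : nat) (P : {poly F}) :
  N.-primitive_root w -> (size P <= N)%N -> (j < N)%N ->
  N%:R * P`_j = \sum_(i < N) P.[w ^+ i] * w ^+ (i * (N - j)).
Proof.
move=> pw sP jN.
have -> : \sum_(i < N) P.[w ^+ i] * w ^+ (i * (N - j)) =
    \sum_(k < N) P`_k * \sum_(i < N) w ^+ (i * (k + (N - j))).
  under eq_bigr => i _ do rewrite (horner_coef_wide _ sP) mulr_suml.
  rewrite exchange_big/=; apply: eq_bigr => k _; rewrite mulr_sumr.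
  by apply: eq_bigr => i _; rewrite -mulrA -exprM -exprD mulnDr.
rewrite (bigD1 (Ordinal jN))//= [X in _ + X]big1 => [|k kj].
  by rewrite sum_prim_root// subnKC ?(ltnW jN)// dvdnn addr0 mulrC.
rewrite sum_prim_root// ifF ?mulr0//; apply/negbTE.
apply: contra kj => /dvdnP[c kc]; rewrite -val_eqE/=.
have kN := ltn_ord k.
have c0 : (0 < c)%N.
  case: c kc => // /eqP.
  by rewrite mul0n addn_eq0 subn_eq0 leqNgt jN andbF.
have c2 : (c < 2)%N.
  rewrite -(@ltn_pmul2r N) ?(leq_ltn_trans _ jN)// -kc mul2n -addnn.
  by rewrite -addSn leq_add// leq_subr.
move: kc; have -> : c = 1%N by case: c c0 c2 => [|[|]].
rewrite mul1n => kc; rewrite -(eqn_add2r (N - j)) kc subnKC//.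
exact: ltnW.
Qed.

(** Cauchy's estimate of the coefficients on the unit circle. *)
Lemma coef_le_circle (R : realType) (P : {poly Rcomplex R}) (M : R) :
  (forall w : Rcomplex R, `|w| = 1 -> `|P.[w] : C R| <= M) ->
  forall j, `|P`_j : C R| <= M.
Proof.
move=> HM j.
have M0 : 0 <= M by apply: le_trans (HM 1 (normRc1 R)).
pose N := maxn (size P) j.+1.
have N0 : (0 < N)%N by rewrite leq_max orbT.
have [w pw] := prim_root_exists R N0.
have nw := prim_root_norm N0 pw.
have jN : (j < N)%N by rewrite leq_max leqnn orbT.
have sP : (size P <= N)%N by rewrite leq_max leqnn.
have := coef_prim_root pw sP jN.
move=> /(congr1 (fun z : C R => `|z|)) /=; rewrite normRcM normRc_nat => H.
rewrite -(@ler_pM2l _ N%:R) ?ltr0n// H.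
apply: (le_trans (ler_norm_sum _ _ _)).
rewrite mulr_natl -[N in leRHS]card_ord -sumr_const; apply: ler_sum => i _.
by rewrite normRcM !normRcX nw expr1n mulr1 HM// normRcX nw expr1n.
Qed.

(** The polynomial [w ^ m * f ((w + 1) ^ 2 / (4 w))] in [w], for [f] of degree
    at most [m].  On the unit circle [(w + 1) ^ 2 / (4 w) = (1 + Re w) / 2] runs
    through the segment [0, 1]. *)
Definition circle_lift (F : fieldType) (m : nat) (f : {poly F}) : {poly F} :=
  \sum_(k < m.+1) f`_k *: ((4%:R^-1 *: ('X + 1) ^+ 2) ^+ k * 'X^(m - k)).

Lemma circle_lift_horner (F : fieldType) (m : nat) (f : {poly F}) (w : F) :
  (size f <= m.+1)%N -> w != 0 ->
  (circle_lift m f).[w] = w ^+ m * f.[4%:R^-1 * (w + 1) ^+ 2 / w].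
Proof.
move=> sf w0; rewrite (horner_coef_wide _ sf) mulr_sumr /circle_lift.
rewrite horner_sum; apply: eq_bigr => k _ /=.
have km : (k <= m)%N by rewrite -ltnS.
rewrite hornerZ hornerM hornerXn horner_exp hornerZ horner_exp hornerD hornerX.
rewrite -polyC1 hornerC expr_div_n.
set a := _ ^+ k.
have -> : w ^+ m = w ^+ k * w ^+ (m - k) by rewrite -exprD subnKC.
have : w ^+ k != 0 by rewrite expf_neq0.
by move: a (w ^+ k) (w ^+ (m - k)) => a b e b0; field.
Qed.

Lemma size_circle_lift (F : fieldType) (m : nat) (f : {poly F}) :
  (size (circle_lift m f) <= (2 * m).+1)%N.
Proof.
apply/(leq_trans (size_sum _ _ _))/bigmax_leqP => k _.
apply: (leq_trans (size_scale_leq _ _)).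
apply: (leq_trans (size_polyMleq _ _)).
rewrite size_polyXn addnS/=.
have sq : (size ((4%:R^-1 : F) *: ('X + 1) ^+ 2) <= 3)%N.
  apply: (leq_trans (size_scale_leq _ _)).
  apply: (leq_trans (size_poly_exp_leq _ _)).
  by rewrite -[X in 'X + X]polyC1 size_XaddC.
have := size_poly_exp_leq (4%:R^-1 *: ('X + 1) ^+ 2 : {poly F}) k.
move=> /leq_trans H; apply: (@leq_trans ((2 * k).+1 + (m - k))).
  rewrite leq_add2r; apply: H; rewrite ltnS leq_mul2r.
  by case: (size _) sq => [|[|[|[]]]] //=; rewrite orbT.
have km : (k <= m)%N by rewrite -ltnS.
by rewrite addSn ltnS mul2n -addnn -addnA subnKC// mul2n -addnn leq_add2r.
Qed.

(** The derivative of [f] at [1] in terms of its lift: the point [1] is critical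
    for [(w + 1) ^ 2 / (4 w)], hence the second derivative. *)
Lemma circle_lift_deriv (F : fieldType) (m : nat) (f : {poly F}) :
  (2%:R != 0 :> F) -> (size f <= m.+1)%N ->
  f^`().[1] = 2 * ((circle_lift m f)^`()^`().[1] - (m%:R * (m%:R - 1)) * f.[1]).
Proof.
move=> two0 sf.
have four0 : 4%:R != 0 :> F.
  by rewrite -[4%N]/(2 * 2)%N natrM mulf_neq0.
have fE : f = \sum_(k < m.+1) f`_k *: 'X^k.
  apply/polyP => i; rewrite -poly_def coef_poly; case: ltnP => // mi.
  by rewrite nth_default// (leq_trans sf).
have -> : f^`().[1] = \sum_(k < m.+1) f`_k * k%:R.
  rewrite {1}fE (raddf_sum (@deriv F)) horner_sum; apply: eq_bigr => k _ /=.
  by rewrite derivZ derivXn !hornerE hornerMn hornerXn expr1n.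
have -> : f.[1] = \sum_(k < m.+1) f`_k.
  rewrite (horner_coef_wide _ sf); apply: eq_bigr => k _ /=.
  by rewrite expr1n mulr1.
rewrite /circle_lift !(raddf_sum (@deriv F)) horner_sum mulr_sumr -sumrB.
rewrite mulr_sumr.
apply: eq_bigr => k _ /=.
have km : (k <= m)%N by rewrite -ltnS.
set l := (m - k)%N.
have -> : m%:R = k%:R + l%:R :> F by rewrite -natrD subnKC.
pose h : {poly F} := 4%:R^-1 *: ('X + 1) ^+ 2.
have h1 : h.[1] = 1.
  by rewrite /h hornerZ horner_exp hornerD hornerX -polyC1 hornerC; field.
have dh : h^`() = 2%:R^-1 *: ('X + 1).
  rewrite /h derivZ deriv_exp derivD derivX derivC addr0 mul1r expr1.
  rewrite -scaler_nat scalerA; have -> // : 4%:R^-1 * 2%:R = 2%:R^-1 :> F.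
  by rewrite -[4%N]/(2 * 2)%N natrM invfM -mulrA mulVf ?mulr1.
have ddh : h^`()^`() = (2%:R^-1)%:P.
  by rewrite dh derivZ derivD derivX derivC addr0 alg_polyC.
have dh1 : h^`().[1] = 1.
  by rewrite dh hornerZ hornerD hornerX -polyC1 hornerC; field.
have pn (j : nat) : j%:R * (j.-1)%:R = j%:R * (j%:R - 1) :> F.
  by case: j => [|j]; rewrite ?mul0r//= -natr1 addrK.
have dhk : (h ^+ k)^`().[1] = k%:R.
  by rewrite deriv_exp hornerMn hornerM horner_exp h1 dh1 expr1n mulr1.
have ddhk : (h ^+ k)^`()^`().[1] = k%:R * 2%:R^-1 + k%:R * (k%:R - 1).
  rewrite deriv_exp derivMn derivM ddh deriv_exp hornerMn hornerD !hornerM.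
  rewrite hornerMn hornerM hornerC !horner_exp h1 dh1 !expr1n !mulr1 !mul1r.
  by rewrite -pn -[RHS]mulrDr mulr_natl.
have dX : ('X^l : {poly F})^`().[1] = l%:R.
  by rewrite derivXn hornerMn hornerXn expr1n.
have ddX : ('X^l : {poly F})^`()^`().[1] = l%:R * (l%:R - 1).
  by rewrite derivXn derivMn derivXn !hornerMn hornerXn expr1n -pn mulr_natl.
rewrite -/h 2!derivZ hornerZ derivM derivD !derivM !hornerD !hornerM.
rewrite dhk ddhk dX ddX hornerXn horner_exp h1 !expr1n !mulr1 !mul1r.
by move: (k%:R : F) (l%:R : F) (f`_k) => a b c; field.
Qed.

(** A Markov inequality at an endpoint, with a cubic factor instead of the sharp
    quadratic one; any subexponential factor would do here. *)
Lemma markov_unit_itv (R : realType) (m : nat) (f : {poly C R}) (M : R) :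
  (size f <= m.+1)%N ->
  (forall x : R, 0 <= x -> x <= 1 -> `|f.[(x%:C)%C] : C R| <= M) ->
  `|f^`().[1] : C R| <= 18%:R * m%:R ^+ 3 * M.
Proof.
move=> sf HM.
have f1 : `|f.[1] : C R| <= M by apply: (HM 1).
have M0 : 0 <= M by apply: le_trans f1.
have two0 : 2%:R != 0 :> C R by rewrite natRc_eq0.
have four0 : 4%:R != 0 :> C R by rewrite natRc_eq0.
have HG j : `|(circle_lift m f)`_j : C R| <= M.
  apply: coef_le_circle => w w1.
  have w0 : w != 0 by rewrite -normr_eq0 w1 oner_eq0.
  rewrite circle_lift_horner// normRcM normRcX w1 expr1n mul1r.
  have -> : 4%:R^-1 * (w + 1) ^+ 2 / w = (((1 + complex.Re w) / 2)%:C)%C.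
    apply: (mulIf w0); rewrite divfK//; apply: (mulfI four0).
    rewrite (mulVKf four0).
    have : `|w| ^+ 2 = 1 by rewrite w1 expr1n.
    rewrite normRc_sqr; case: w {w0 w1} => a b /= ab1.
    have -> : (4%:R : C R) = ((4%:R : R)%:C)%C.
      exact: (esym (rmorph_nat (@real_complex R) 4)).
    by apply/eqP; rewrite eq_complex/=; apply/andP; split; apply/eqP; nra.
  have := normRc_Re w; rewrite w1 ler_norml => /andP[? ?].
  by apply: HM; lra.
rewrite (circle_lift_deriv two0 sf) normRcM normRc_nat.
case: m sf HG => [|m] sf HG.
  rewrite [circle_lift _ _](@size1_polyC _ _ _); last first.
    by apply: leq_trans (size_circle_lift _ _) _.
  rewrite derivC deriv0 horner0 mul0r mul0r subrr normr0 mulr0.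
  by rewrite !mulr_ge0// exprn_ge0.
set m1 := m.+1 in sf HG *.
set G := circle_lift m1 f.
have sG : (size G^`()^`() <= (2 * m1).-1)%N.
  apply/leq_sizeP => j hj; rewrite !coef_deriv nth_default ?mul0rn//.
  apply: (leq_trans (size_circle_lift _ _)).
  by rewrite ltnS; move: hj; rewrite -subn1 leq_subLR add1n.
(* at most [2 m] coefficients of [G], each multiplied by at most [(2 m) ^ 2] *)
have H2 : `|G^`()^`().[1] : C R| <= 8%:R * m1%:R ^+ 3 * M.
  rewrite (horner_coef_wide _ sG); apply: (le_trans (ler_norm_sum _ _ _)).
  apply: (@le_trans _ _ (\sum_(i < (2 * m1).-1) (4%:R * m1%:R ^+ 2 * M))).
    apply: ler_sum => i _.
    rewrite expr1n mulr1 !coef_deriv !normrMn -mulrnA -[X in X <= _]mulr_natl.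
    apply: ler_pM => //.
    have -> : 4%:R * m1%:R ^+ 2 = ((2 * m1) * (2 * m1))%:R :> R.
      by rewrite !natrM; ring.
    rewrite ler_nat; have hi : (i.+1 < 2 * m1)%N by rewrite -ltn_predRL ltn_ord.
    by apply: leq_mul => //; apply: ltnW.
  rewrite sumr_const card_ord -[X in X <= _]mulr_natl.
  have hh : ((2 * m1).-1)%:R <= 2%:R * m1%:R :> R.
    by rewrite -natrM ler_nat leq_pred.
  have P0 : 0 <= 4%:R * m1%:R ^+ 2 * M by rewrite !mulr_ge0// exprn_ge0.
  by apply: le_trans (ler_wpM2r P0 hh) _; rewrite exprS; lra.
have H1 : `|m1%:R * (m1%:R - 1) * f.[1] : C R| <= m1%:R ^+ 3 * M.
  have -> : m1%:R - 1 = m%:R :> C R by rewrite -natr1 addrK.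
  rewrite !normRcM !normRc_nat; apply: ler_pM => //.
  rewrite exprS expr2 ler_pM2l ?ltr0n//.
  rewrite -natrM ler_nat (leq_trans (leqnSn m))//.
  by rewrite -[m.+1]/m1 leq_pmulr.
have H3 := le_trans (ler_normB _ _) (lerD H2 H1).
by apply: (le_trans (ler_wpM2l _ H3)) => //; lra.
Qed.

Lemma size_comp_affine (F : fieldType) (f : {poly F}) (a b : F) (m : nat) :
  (size f <= m.+1)%N -> (size (f \Po (a%:P + b *: 'X)) <= m.+1)%N.
Proof.
move=> sf; apply: (leq_trans (size_comp_poly_leq _ _)); rewrite ltnS.
have sq : (size (a%:P + b *: 'X)%R <= 2)%N.
  rewrite (leq_trans (size_polyD _ _))// geq_max.
  rewrite (leq_trans (size_polyC_leq1 _))//=.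
  by rewrite (leq_trans (size_scale_leq _ _))// size_polyX.
rewrite -[m]muln1; apply: leq_mul; first by case: (size f) sf.
by case: (size _) sq => [|[|[]]].
Qed.

Lemma horner_comp_affine (F : fieldType) (f : {poly F}) (a b x : F) :
  (f \Po (a%:P + b *: 'X)).[x] = f.[a + b * x].
Proof. by rewrite horner_comp hornerD hornerC hornerZ hornerX. Qed.

Lemma deriv_comp_affine (F : fieldType) (f : {poly F}) (a b : F) :
  (f \Po (a%:P + b *: 'X))^`() = (f^`() \Po (a%:P + b *: 'X)) * b%:P.
Proof.
by rewrite deriv_comp derivD derivC derivZ derivX add0r alg_polyC.
Qed.

Lemma markov_segment (R : realType) (m : nat) (f : {poly C R}) (a b : C R)
    (M : R) : (size f <= m.+1)%N ->
  (forall u : R, 0 <= u -> u <= 1 ->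
     `|f.[a + (b - a) * ((u%:C)%C : C R)] : C R| <= M) ->
  `|f^`().[b] : C R| * `|b - a : C R| <= 18%:R * m%:R ^+ 3 * M.
Proof.
move=> sf HM; have := @markov_unit_itv _ m (f \Po (a%:P + (b - a) *: 'X)) M.
rewrite deriv_comp_affine hornerM hornerC horner_comp_affine mulr1 subrKC.
rewrite normRcM; apply; first exact: size_comp_affine.
by move=> u u0 u1; rewrite horner_comp_affine; exact: HM.
Qed.

(** The real polynomial whose coefficients are the real parts of those of [p];
    on the real line its values are the real parts of those of [p]. *)
Definition Re_poly (R : realType) (p : {poly C R}) : {poly R} :=
  \poly_(i < size p) complex.Re p`_i.

Lemma coef_Re_poly (R : realType) (p : {poly C R}) i :
  (Re_poly p)`_i = complex.Re p`_i.
Proof. by rewrite coef_poly; case: ltnP => // ?; rewrite nth_default. Qed.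

Lemma horner_Re_poly (R : realType) (p : {poly C R}) (u : R) :
  (Re_poly p).[u] = complex.Re (p.[(u%:C)%C]).
Proof.
rewrite horner_poly horner_coef.
rewrite (raddf_sum (@complex.Re R : C R -> R)); apply: eq_bigr => i _ /=.
have -> : ((u%:C)%C : C R) ^+ i = (((u ^+ i)%:C)%C : C R).
  exact: (esym (rmorphXn (@real_complex R) i u)).
by case: (p`_i) => a b /=; rewrite mulr0 subr0.
Qed.

Lemma deriv_Re_poly (R : realType) (p : {poly C R}) :
  (Re_poly p)^`() = Re_poly p^`().
Proof.
apply/polyP => i; rewrite coef_deriv !coef_Re_poly coef_deriv.
by rewrite (raddfMn (@complex.Re R : C R -> R)).
Qed.

(** The mean value inequality on a segment. *)
Lemma poly_increment_le (R : realType) (f : {poly C R}) (a b : C R) (M : R) :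
  (forall u : R, 0 <= u -> u <= 1 ->
     `|f^`().[a + (b - a) * ((u%:C)%C : C R)] : C R| <= M) ->
  `|f.[b] - f.[a] : C R| <= M * `|b - a|.
Proof.
move=> HM; pose F := f \Po (a%:P + (b - a) *: 'X).
have F1 : F.[1] = f.[b] by rewrite horner_comp_affine mulr1 subrKC.
have F0 : F.[0] = f.[a] by rewrite horner_comp_affine mulr0 addr0.
have [->|nz] := eqVneq (f.[b] - f.[a]) 0.
  by rewrite normr0 mulr_ge0// (le_trans _ (HM 0 _ _)).
pose c : C R := conjc (f.[b] - f.[a]).
have nc : `|c| = `|f.[b] - f.[a] : C R|.
  apply/eqP; rewrite -(@eqrXn2 _ 2)// !normRc_sqr /c.
  by case: (_ - _) => x y /=; rewrite sqrrN.
(* [c] makes [Re (c * F)] increase by [`|f.[b] - f.[a]| ^+ 2] between 0 and 1 *)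
have [u] := poly_mvt (Re_poly (c *: F)) (@ltr01 R).
rewrite in_itv/= => /andP[u0 u1].
rewrite deriv_Re_poly !horner_Re_poly derivZ !hornerZ.
rewrite [((1%:C)%C : C R)](_ : _ = 1)// [((0%:C)%C : C R)](_ : _ = 0)//.
rewrite F1 F0 subr0 mulr1 -raddfB/= -mulrBr.
have -> : complex.Re (c * (f.[b] - f.[a])) = `|f.[b] - f.[a] : C R| ^+ 2.
  rewrite normRc_sqr /c; case: (_ - _) => x y /=; ring.
move=> H; rewrite -(@ler_pM2l _ `|f.[b] - f.[a] : C R|) ?normr_gt0//.
rewrite -expr2 H; apply: (le_trans (ler_norm _)).
apply: (le_trans (normRc_Re _)); rewrite normRcM nc ler_wpM2l//.
rewrite deriv_comp_affine hornerM hornerC horner_comp_affine normRcM.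
by rewrite ler_wpM2r// HM// ltW.
Qed.

(** The logarithmic derivative of a product of linear factors. *)
Lemma deriv_prod_XsubC (F : fieldType) (rs : seq F) (z : F) : z \notin rs ->
  (\prod_(r <- rs) ('X - r%:P))^`().[z] =
  (\prod_(r <- rs) ('X - r%:P)).[z] * \sum_(r <- rs) (z - r)^-1.
Proof.
elim: rs => [|r rs IH]; first by rewrite !big_nil derivC horner0 mulr0.
rewrite inE negb_or => /andP[zr /IH {}IH]; rewrite !big_cons derivM.
rewrite hornerD !hornerM IH derivXsubC hornerC hornerXsubC mul1r.
have : z - r != 0 by rewrite subr_eq0.
by move: (z - r) (_.[z]) (\sum_(_ <- _) _) => a b c a0; field.
Qed.

(** A polynomial whose modulus is maximal at the centre of a disc has that
    modulus on the whole circle. *)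
Lemma maximum_principle_disc (R : realType) (f : {poly C R}) (z0 v : C R) :
  (forall w : C R, `|w - z0| <= `|v| -> `|f.[w] : C R| <= `|f.[z0] : C R|) ->
  `|f.[z0] : C R| <= `|f.[z0 + v] : C R|.
Proof.
move=> Hmax; pose N := (size f).+1.
have [w pw] := prim_root_exists R (ltn0Sn (size f)).
have nw := prim_root_norm (ltn0Sn _) pw.
have sP : (size (f \Po (z0%:P + v *: 'X)) <= N)%N.
  by apply: size_comp_affine; exact: leqnSn.
(* the value at the centre is the mean of the values at the vertices of a
   regular polygon, one of which is [z0 + v] *)
have := coef_prim_root pw sP (ltn0Sn _).
rewrite -horner_coef0 horner_comp_affine mulr0 addr0.
move=> /(congr1 (fun z : C R => `|z|)) /=; rewrite normRcM normRc_nat => H.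
have : N%:R * `|f.[z0] : C R| <=
    `|f.[z0 + v] : C R| + (size f)%:R * `|f.[z0] : C R|.
  rewrite [leLHS]H big_ord_recl; apply: (le_trans (ler_normD _ _)).
  apply: lerD.
    by rewrite mul0n expr0 !mulr1 horner_comp_affine mulr1.
  apply: (le_trans (ler_norm_sum _ _ _)).
  rewrite mulr_natl -[X in _ *+ X]card_ord -sumr_const; apply: ler_sum => i _.
  rewrite normRcM !normRcX nw expr1n mulr1 horner_comp_affine Hmax//.
  by rewrite addrAC subrr add0r normRcM normRcX nw expr1n mulr1.
by rewrite -natr1 mulrDl mul1r addrC lerD2r.
Qed.

(** * Transfinite diameter and monic polynomials *)

Lemma cube_geometric_bounded (R : realType) (theta : R) :
  0 <= theta -> theta < 1 ->
  exists2 B : R, 0 < B & forall n : nat, n%:R ^+ 3 * theta ^+ n <= B.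
Proof.
move=> t0 t1; have [->|tn0] := eqVneq theta 0.
  exists 1 => // -[|n]; first by rewrite expr0n mul0r.
  by rewrite expr0n mulr0.
have {tn0}t0 : 0 < theta by rewrite lt_neqAle eq_sym tn0.
pose s := - ln theta.
have s0 : 0 < s by rewrite oppr_gt0 ln_lt0// t0.
have tE : theta = expR (- s) by rewrite opprK lnK.
exists ((3 / s) ^+ 3) => [|n]; first by rewrite exprn_gt0// divr_gt0.
have -> : theta ^+ n = expR (- (s * n%:R / 3)) ^+ 3.
  rewrite tE -!expRM_natr; congr expR; by field.
rewrite -exprMn lerXn2r ?nnegrE//.
  by rewrite divr_ge0// ltW.
have y0 : 0 <= s * n%:R / 3 by rewrite divr_ge0// mulr_ge0// ltW.
set y := s * n%:R / 3 in y0 *.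
have -> : n%:R = 3 / s * y by rewrite /y; field; rewrite gt_eqF.
rewrite -[leRHS]mulr1 -[leLHS]mulrA ler_pM2l ?divr_gt0//.
rewrite expRN ler_pdivrMr ?expR_gt0// mul1r.
by apply: le_trans (expR_ge1Dx _); rewrite lerDr.
Qed.

Lemma prod_expr_divn (R : comNzRingType) (M : R) (m r : nat) : (0 < m)%N ->
  \prod_(j < m * r) M ^+ (j %/ m) = M ^+ (m * 'C(r, 2)).
Proof.
move=> m0; elim: r => [|r IH]; first by rewrite !muln0 big_ord0.
rewrite -(big_mkord xpredT (fun j => M ^+ (j %/ m))).
rewrite mulnS addnC (@big_cat_nat _ _ _ (m * r)) ?leq_addr//=.
rewrite big_mkord IH -{1}[(m * r)%N]add0n big_addn addKn big_mkord.
rewrite (eq_bigr (fun=> M ^+ r)) => [|i _].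
  rewrite prodr_const card_ord -exprM -exprD binS bin1 mulnDr.
  by rewrite addnC [(r * m)%N]mulnC addnC.
by rewrite addnC mulnC divnMDl// divn_small// addn0.
Qed.

Lemma leq_fact_expn n : (n`! <= n ^ n)%N.
Proof.
elim: n => // n IH; rewrite factS expnS leq_mul2l/=.
by apply: (leq_trans IH); case: n {IH} => // n; rewrite leq_exp2r.
Qed.

(** Bound on the Vandermonde product of points of a set, by expressing it as a
    determinant of values of monic polynomials. *)
Lemma vandermonde_le (R : realType) (N : nat) (z : 'I_N -> C R)
    (f : nat -> {poly C R}) (B : nat -> R) :
  (forall j, f j \is monic) -> (forall j, size (f j) = j.+1) ->
  (forall j i, `|(f j).[z i] : C R| <= B j) ->
  \prod_(i < N) \prod_(j < N | (i < j)%N) `|z i - z j| <=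
  N`!%:R * \prod_(j < N) B j.
Proof.
move=> fm fs fB.
pose T : 'M[C R]_N := \matrix_(j, l) (f j)`_l.
pose V : 'M[C R]_N := Vandermonde N (\row_i z i).
pose A : 'M[C R]_N := \matrix_(j, i) (f j).[z i].
have AE : A = T *m V.
  apply/matrixP => j i; rewrite !mxE.
  rewrite (@horner_coef_wide _ N) ?fs//.
  by apply: eq_bigr => l _; rewrite !mxE.
have detT : \det T = 1.
  rewrite det_trig.
    rewrite big1// => i _; rewrite mxE.
    by have /monicP := fm i; rewrite lead_coefE fs.
  apply/is_trig_mxP => i j ij; rewrite mxE nth_default// fs.
  exact: ij.
have -> : \prod_(i < N) \prod_(j < N | (i < j)%N) `|z i - z j| =
    `|\det A : C R|.
  rewrite AE det_mulmx detT mul1r det_Vandermonde normRc_prod.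
  apply: eq_bigr => i _; rewrite normRc_prod; apply: eq_bigr => j _.
  by rewrite !mxE distrC.
rewrite /determinant; apply: (le_trans (ler_norm_sum _ _ _)).
rewrite -card_Sn mulr_natl.
rewrite -sumr_const; apply: ler_sum => s _.
rewrite normRcM normRcX normrN normRc1 expr1n mul1r normRc_prod.
by apply: ler_prod => i _; rewrite normr_ge0 mxE fB.
Qed.

(** The previous bound for the monic polynomials [f ^ (j / m) * 'X ^ (j mod m)],
    whose values on [K] are at most [D ^ m * M ^ (j / m)]. *)
Lemma vandermonde_le_power (R : realType) (K : set (C R)) (D : R)
    (f : {poly C R}) (m r : nat) (M : R) (z : 'I_(m * r) -> C R) :
  (0 < m)%N -> 1 <= D -> 0 <= M -> (forall x, K x -> `|x| <= D) ->
  f \is monic -> size f = m.+1 ->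
  (forall x, K x -> `|f.[x] : C R| <= M) -> (forall i, K (z i)) ->
  \prod_(i < m * r) \prod_(j < m * r | (i < j)%N) `|z i - z j| <=
  ((m * r)%:R * D ^+ m) ^+ (m * r) * M ^+ (m * 'C(r, 2)).
Proof.
move=> m0 D1 M0 KD fm sf fM Kz.
pose g j : {poly C R} := f ^+ (j %/ m) * 'X^(j %% m).
have gm j : g j \is monic by rewrite monicMl ?monicXn// monic_exp.
have gs j : size (g j) = j.+1.
  rewrite size_monicM ?monic_exp// ?monic_neq0 ?monicXn//.
  rewrite size_polyXn addnS/= polySpred ?monic_neq0 ?monic_exp//.
  by rewrite size_exp sf/= addSn mulnC -divn_eq.
have D0 : 0 <= D by apply: le_trans D1.
pose B j := D ^+ m * M ^+ (j %/ m).
have gB j i : `|(g j).[z i] : C R| <= B j.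
  rewrite /g hornerM horner_exp hornerXn normRcM !normRcX mulrC.
  apply: ler_pM; rewrite ?exprn_ge0//; last by rewrite lerXn2r ?nnegrE// fM.
  apply: (@le_trans _ _ (D ^+ (j %% m))); first by rewrite lerXn2r ?nnegrE// KD.
  by rewrite ler_weXn2l// ltnW// ltn_pmod.
apply: (le_trans (vandermonde_le gm gs gB)).
rewrite /B big_split/= prod_expr_divn// prodr_const card_ord mulrA.
rewrite ler_wpM2r ?exprn_ge0// exprMn ler_wpM2r ?exprn_ge0//.
by rewrite -natrX ler_nat leq_fact_expn.
Qed.

Lemma nth_diameter_gt (R : realType) (K : set (C R)) (N : nat) (b : R) :
  (1 < N)%N -> 0 <= b -> K !=set0 -> b < nth_diameter K N ->
  exists2 z : 'I_N -> C R, (forall i, K (z i)) &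
    b ^+ 'C(N, 2) <= \prod_(i < N) \prod_(j < N | (i < j)%N) `|z i - z j|.
Proof.
move=> N1 b0 [x Kx] /sup_gt[].
  by eexists; exists (fun=> x) => /=.
move=> y [z Kz <-] bz; exists z => //.
set V := \prod_(i < N) _ in bz *.
have V0 : 0 <= V by rewrite !prodr_ge0// => i _; rewrite prodr_ge0.
set e := 2 / _ in bz.
have e0 : 0 < e.
  by rewrite divr_gt0// ltr0n muln_gt0; case: N N1 {z Kz V V0 bz e} => [|[]].
have eE : e * ('C(N, 2))%:R = 1.
  have -> : e = 2 / (2 * ('C(N, 2))%:R).
    by rewrite /e -natrM -mul_bin_diag bin1.
  by field; rewrite pnatr_eq0 -lt0n bin_gt0.
have E0 : (0 < 'C(N, 2))%N by rewrite bin_gt0.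
have := gt0_ltr_powR (_ : 0 < ('C(N, 2))%:R).
move=> /(_ R); rewrite ltr0n => /(_ E0).
move=> /(_ b (V `^ e)); rewrite !nnegrE b0 powR_ge0 => /(_ isT isT bz).
by rewrite -powRrM eE powRr1// powR_mulrn// => /ltW.
Qed.

(** On a set of transfinite diameter [Delta] the maximum modulus of a monic
    polynomial of degree [m] is at least [Delta ^ m]. *)
Lemma transfinite_diameter_le (R : realType) (K : set (C R)) (Delta D : R)
    (f : {poly C R}) (m : nat) (M : R) :
  is_transfinite_diameter K Delta -> 0 < Delta -> K !=set0 ->
  1 <= D -> (forall x, K x -> `|x| <= D) ->
  f \is monic -> size f = m.+1 ->
  (forall x, K x -> `|f.[x] : C R| <= M) -> Delta ^+ m <= M.
Proof.
move=> KDelta Delta0 K0 D1 KD fm sf fM.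
have [x0 Kx0] := K0.
have M0 : 0 <= M by apply: le_trans (fM _ Kx0).
have [m0|m0] := posnP m.
  move: (fM _ Kx0); have -> : f = 1.
    have : size f = 1%N by rewrite sf m0.
    move/eqP/size_poly1P => [c _ fE].
    by move: fm; rewrite fE monicE lead_coefC => /eqP ->.
  by rewrite hornerC normRc1 m0.
rewrite leNgt; apply/negP => MD.
have [b [b0 bD Mb]] : exists b, [/\ 0 < b, b < Delta & M < b ^+ m].
  have cX : (fun x : R => x ^+ m) x @[x --> Delta] --> Delta ^+ m.
    exact: exprn_continuous.
  have [e /= e0 He] : \forall x \near Delta, M < x ^+ m.
    exact: (cvgr_gt (Delta ^+ m) cX _ MD).
  pose b := Delta - Num.min (Delta / 2) (e / 2).
  have h1 : 0 < Num.min (Delta / 2) (e / 2) by rewrite lt_min !divr_gt0.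
  have h2 : Num.min (Delta / 2) (e / 2) <= Delta / 2 by rewrite ge_min lexx.
  have h3 : Num.min (Delta / 2) (e / 2) <= e / 2 by rewrite ge_min lexx orbT.
  exists b; rewrite /b; split; [lra|lra|].
  by apply: He; rewrite /ball/= opprB addrC subrK gtr0_norm//; lra.
pose theta := M / b ^+ m.
have th0 : 0 <= theta by rewrite divr_ge0// exprn_ge0// ltW.
have th1 : theta < 1 by rewrite ltr_pdivrMr ?exprn_gt0// mul1r.
have ME : M = theta * b ^+ m by rewrite divfK// gt_eqF// exprn_gt0.
have [B B0 HB] := cube_geometric_bounded th0 th1.
have [N0 _ HN0] : \forall n \near \oo, b < nth_diameter K n.
  exact: (cvgr_gt Delta KDelta b bD).
pose Q := (m%:R * D ^+ m) ^+ 2 : R.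
(* comparison of both bounds for the Vandermonde product of [m * r] points *)
have key r : (1 < r)%N -> (N0 <= r)%N ->
    b ^+ m.-1 <= Q * r%:R ^+ 2 * theta ^+ r.-1.
  move=> r1 N0r.
  have rN : (r <= m * r)%N by rewrite leq_pmull.
  have [z Kz bz] := nth_diameter_gt (leq_trans r1 rN) (ltW b0) K0
    (HN0 _ (leq_trans N0r rN)).
  have := le_trans bz (vandermonde_le_power m0 D1 M0 KD fm sf fM Kz).
  set N := (m * r)%N.
  have NN : N = (m * r)%N by [].
  have N_gt0 : (0 < N)%N by rewrite (leq_trans _ rN)// ltnW.
  have EN : ('C(N, 2) * 2 = N * m.-1 + N * (m * r.-1))%N.
    rewrite mulnC -mul_bin_diag bin1 -mulnDr NN; congr (_ * _)%N.
    case: r r1 {N0r rN z Kz bz N NN N_gt0} => // r _.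
    case: m m0 {fm sf fM MD Mb theta th0 th1 ME HB Q} => // m' _.
    by rewrite mulnS.
  have Er : (m * 'C(r, 2) * 2 = N * r.-1)%N.
    by rewrite -mulnA [('C(_, _) * 2)%N]mulnC -mul_bin_diag bin1 mulnA.
  have X0 : 0 <= N%:R * D ^+ m.
    by rewrite mulr_ge0// exprn_ge0// (le_trans _ D1).
  have bX n : 0 <= b ^+ n by rewrite exprn_ge0// ltW.
  move=> H.
  have : (b ^+ 'C(N, 2)) ^+ 2 <=
      ((N%:R * D ^+ m) ^+ N * M ^+ (m * 'C(r, 2))) ^+ 2.
    by rewrite lerXn2r ?nnegrE// mulr_ge0// exprn_ge0.
  have X2 : (N%:R * D ^+ m) ^+ 2 = Q * r%:R ^+ 2 by rewrite /Q NN natrM; ring.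
  have M2 : (M ^+ (m * 'C(r, 2))) ^+ 2 =
      (theta ^+ r.-1) ^+ N * b ^+ (N * (m * r.-1)).
    by rewrite -exprM Er ME exprMn -!exprM [(r.-1 * N)%N]mulnC mulnCA.
  have b2 : (b ^+ 'C(N, 2)) ^+ 2 = (b ^+ m.-1) ^+ N * b ^+ (N * (m * r.-1)).
    by rewrite -!exprM -exprD EN [(m.-1 * N)%N]mulnC.
  rewrite b2 [in X in _ <= X]exprMn M2 [((N%:R * D ^+ m) ^+ N) ^+ 2]exprAC X2.
  rewrite mulrA -exprMn.
  rewrite ler_pM2r ?exprn_gt0// => {}H.
  have D00 : 0 <= D by exact: le_trans D1.
  by move: H; rewrite ler_pXn2r// nnegrE// !mulr_ge0// !exprn_ge0.
have tX0 n : 0 <= theta ^+ n by rewrite exprn_ge0.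
(* for large [r] this contradicts [theta < 1] *)
have bm0 : 0 < b ^+ m.-1 by rewrite exprn_gt0.
have Q0 : 0 <= Q by rewrite exprn_ge0// mulr_ge0// exprn_ge0// (le_trans _ D1).
pose k0 := (maxn N0 (Num.truncn (Q * 4%:R * B / b ^+ m.-1)).+1).+1.
have k1 : (1 < k0)%N by rewrite ltnS leq_max orbT.
have N0k : (N0 <= k0)%N by rewrite leqW// leq_max leqnn.
have := key k0 k1 N0k; rewrite /k0 /=.
set x := maxn _ _; have := HB x.
have x1 : 1 <= x%:R :> R by rewrite ler1n leq_max orbT.
have xB : Q * 4%:R * B / b ^+ m.-1 < x%:R.
  apply: lt_le_trans (truncnS_gt _) _; by rewrite ler_nat leq_max leqnn orbT.
rewrite ltr_pdivrMr// in xB.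
rewrite -natr1; move: (theta ^+ x) (tX0 x) => tx tx0 h1 h2.
have h3 : Q * (x%:R + 1) ^+ 2 * tx <= Q * (2 * x%:R) ^+ 2 * tx.
  by rewrite ler_wpM2r// ler_wpM2l// lerXn2r ?nnegrE//; lra.
have h4 : x%:R * b ^+ m.-1 <= x%:R * (Q * (2 * x%:R) ^+ 2 * tx).
  by rewrite ler_wpM2l// (le_trans h2).
have h5 : Q * 4%:R * (x%:R ^+ 3 * tx) <= Q * 4%:R * B.
  by rewrite ler_wpM2l// mulr_ge0.
have h6 : x%:R * (Q * (2 * x%:R) ^+ 2 * tx) = Q * 4%:R * (x%:R ^+ 3 * tx).
  by ring.
by move: h4; rewrite h6; lra.
Qed.

(** * The boundary curve, its tangent frame and supporting lines *)

(** The complex number of modulus 1 and argument [th]. *)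
Definition unit_dir (R : realType) (th : R) : C R :=
  Complex (cos th) (sin th).

(** The coordinates of [z] in the orthonormal frame whose first axis has
    direction [th]. *)
Definition along (R : realType) (th : R) (z : C R) : R :=
  complex.Re z * cos th + complex.Im z * sin th.

Definition height (R : realType) (th : R) (z : C R) : R :=
  complex.Im z * cos th - complex.Re z * sin th.

Section frame.
Variable R : realType.
Implicit Types (th a : R) (z w : C R).

Lemma alongB th z w : along th (z - w) = along th z - along th w.
Proof. by case: z w => [a b] [c d]; rewrite /along/=; ring. Qed.

Lemma heightB th z w : height th (z - w) = height th z - height th w.
Proof. by case: z w => [a b] [c d]; rewrite /height/=; ring. Qed.

Lemma heightD th z w : height th (z + w) = height th z + height th w.
Proof. by case: z w => [a b] [c d]; rewrite /height/=; ring. Qed.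

Lemma alongZ th a z : along th (a *: z) = a * along th z.
Proof. by case: z => [b c]; rewrite /along/=; ring. Qed.

Lemma heightZ th a z : height th (a *: z) = a * height th z.
Proof. by case: z => [b c]; rewrite /height/=; ring. Qed.

Lemma norm_frame th z : `|z| ^+ 2 = along th z ^+ 2 + height th z ^+ 2.
Proof.
rewrite normRc_sqr /along /height -[LHS]mulr1 -(cos2Dsin2 th); ring.
Qed.

Lemma along_le th z : `|along th z| <= `|z|.
Proof.
rewrite -(@ler_pXn2r _ 2)// ?nnegrE//.
by rewrite (norm_frame th) real_normK ?num_real// lerDl sqr_ge0.
Qed.

Lemma height_le th z : `|height th z| <= `|z|.
Proof.
rewrite -(@ler_pXn2r _ 2)// ?nnegrE//.
by rewrite (norm_frame th) real_normK ?num_real// lerDr sqr_ge0.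
Qed.

Lemma along_unit_dir th a : along th (unit_dir a) = cos (a - th).
Proof. by rewrite cosB. Qed.

Lemma height_unit_dir th a : height th (unit_dir a) = sin (a - th).
Proof. by rewrite sinB /height/=; ring. Qed.

Lemma height_rotate th a z :
  height (th + a) z = height th z * cos a - along th z * sin a.
Proof. by rewrite /height /along sinD cosD; ring. Qed.

Lemma norm_unit_dir th : `|unit_dir th| = 1.
Proof.
apply/eqP; rewrite -(@pexpr_eq1 _ _ 2)// normRc_sqr /=.
by rewrite cos2Dsin2.
Qed.

End frame.

Lemma arclength_lipschitz (R : realType) (K : set (C R)) (L : R)
    (g : R -> C R) :
  arclength_parametrization K L g ->
  forall s t, s <= t -> `|g t - g s| <= t - s.
Proof.
move=> [_ _ _ Hlen _] s t; rewrite le_eqVlt => /predU1P[->|st].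
  by rewrite !subrr normr0.
rewrite -lee_fin -(Hlen s t (ltW st)).
apply: ereal_sup_ubound; exists [:: t]; first exact: itv_partition1.
by rewrite /= big_nat1.
Qed.

(** Differentiability for increments straddling the point. *)
Lemma is_derive_increment (R : realType) (g : R -> C R) (t : R) (w : C R) :
  is_derive t 1 g w -> forall e : R, 0 < e -> exists2 r : R, 0 < r &
  forall s u, t - r < s -> s <= t -> t <= u -> u < t + r ->
    `|g u - g s - (u - s) *: w| <= e * (u - s).
Proof.
move=> [dg gw] e e0.
have H : h^-1 *: (g (h + t) - g t) @[h --> 0^'] --> w.
  rewrite -gw /derive.
  have -> : (fun h => h^-1 *: (g (h + t) - g t)) =
     (fun h => h^-1 *: ((g \o shift t) (h *: 1) - g t)).
    by apply/funext => h /=; rewrite /GRing.scale/= mulr1.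
  exact: dg.
have /cvgrPdist_le/(_ e e0) := H.
rewrite near_withinE => -[r /= r0 Hr]; exists r => // s u ts st tu ut.
have key h : `|h| < r -> `|g (h + t) - g t - h *: w| <= e * `|h|.
  move=> hr; have [->|h0] := eqVneq h 0.
    by rewrite add0r subrr scale0r subr0 !normr0 mulr0.
  have := Hr h; rewrite /ball/= sub0r normrN => /(_ hr h0).
  rewrite -(@ler_pM2l _ `|h|) ?normr_gt0// -Rcomplex_normrZ scalerBr.
  by rewrite scalerA divff// scale1r distrC [X in _ <= X]mulrC.
have h1 : `|g u - g t - (u - t) *: w| <= e * (u - t).
  have := key (u - t); rewrite subrK ger0_norm ?subr_ge0//; apply; lra.
have h2 : `|g s - g t - (s - t) *: w| <= e * (t - s).
  have := key (s - t); rewrite subrK distrC ger0_norm ?subr_ge0//; apply; lra.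
have -> : g u - g s - (u - s) *: w =
    (g u - g t - (u - t) *: w) - (g s - g t - (s - t) *: w).
  have -> : (u - s) *: w = (u - t) *: w - (s - t) *: w.
    by rewrite -scalerBl; congr (_ *: _); ring.
  by move: (g u) (g s) (g t) (_ *: w) (_ *: w) => *; ring.
by apply: (le_trans (ler_normB _ _)); lra.
Qed.

(** Growth of a linear functional of modulus at most 1 along the curve. *)
Lemma functional_increment_ge (R : realType) (K : set (C R)) (L : R)
    (g : R -> C R) (alpha : R -> R) (ell : C R -> R) (a b c : R) :
  arclength_parametrization K L g -> tangent_angle L g alpha ->
  (forall z w, ell (z - w) = ell z - ell w) ->
  (forall x z, ell (x *: z) = x * ell z) ->
  (forall z, `|ell z| <= `|z|) ->
  a <= b -> (forall t, a < t -> t < b -> c <= ell (unit_dir (alpha t))) ->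
  c * (b - a) <= ell (g b) - ell (g a).
Proof.
move=> Hg [_ _ negN] ellB ellZ ell1 ab Hc.
have lip := arclength_lipschitz Hg.
apply: (@increment_ge_ae _ (ell \o g) a b c 1 _ ab ler01 negN) => [s t st|].
  rewrite /= -ellB mulN1r; have := le_trans (ell1 _) (lip _ _ st).
  by rewrite ler_norml => /andP[].
move=> t at_ tb Nt e e0.
have {}Nt : is_derive t 1 g (unit_dir (alpha t)) by exact: contrapT.
have [r r0 Hr] := is_derive_increment Nt e0.
exists r => // s u ts st tu ut /=; rewrite -ellB.
have := le_trans (ell1 _) (Hr s u ts st tu ut).
rewrite (ellB (_ - _)) ellZ ler_norml => /andP[h1 _].
have := ler_wpM2r (_ : 0 <= u - s) (Hc _ at_ tb); lra.
Qed.

Lemma compact_convex_closed (R : realType) (K : set (C R)) :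
  compact_convex_domain K -> closed K.
Proof.
by case=> cK _ _; apply: compact_closed => //; exact: norm_hausdorff.
Qed.

Lemma boundary_sub (R : realType) (K : set (C R)) :
  compact_convex_domain K -> boundary K `<=` K.
Proof.
move=> /compact_convex_closed cK z [+ _].
by have /closure_id <- := cK.
Qed.

Lemma compact_norm_bounded (R : realType) (K : set (C R)) :
  compact K -> exists2 D : R, 1 <= D & forall z, K z -> `|z| <= D.
Proof.
move=> /compact_bounded [M [_ HM]].
exists (Num.max 1 (M + 1)); first by rewrite le_max lexx.
move=> z Kz; apply: (HM (Num.max 1 (M + 1))) => //.
by rewrite lt_max ltrDl ltr01 orbT.
Qed.

Lemma convex_segment (R : realType) (K : set (C R)) (x y : C R) (u : R) :
  compact_convex_domain K -> K x -> K y -> 0 <= u -> u <= 1 ->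
  K (x + u *: (y - x)).
Proof.
move=> [_ cK _] Kx Ky u0 u1.
have u01 : Itv.spec (@Itv.num_sem R) (Itv.Real `[0%Z, 1%Z]) u.
  by apply/and3P; rewrite ?num_real !bnd_simp.
pose k : {i01 R} := Itv.mk u01.
have := cK y x k; rewrite !inE => /(_ Ky Kx).
have -> // : conv k (y : convex_lmodType (C R)) x = x + u *: (y - x).
change (u *: y + (1 - u) *: x = x + u *: (y - x)).
by rewrite scalerBl scale1r scalerBr addrCA.
Qed.

(** Every ray from a point of the domain meets the boundary. *)
Lemma ray_boundary (R : realType) (K : set (C R)) (z0 e : C R) :
  compact_convex_domain K -> K z0 -> e != 0 ->
  exists2 s : R, 0 <= s & boundary K (z0 + s *: e).
Proof.
move=> KK Kz0 e0; have [cK _ _] := KK.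
have clK := compact_convex_closed KK.
have [D D1 KD] := compact_norm_bounded cK.
pose S := [set s : R | 0 <= s /\ K (z0 + s *: e)].
have S0 : S 0 by split; rewrite // scale0r addr0.
have ne : 0 < `|e| by rewrite normr_gt0.
have ubS : ubound S ((D + D) / `|e|).
  move=> s [s0 Ks]; rewrite ler_pdivlMr//.
  have <- : `|s *: e| = s * `|e| by rewrite Rcomplex_normrZ ger0_norm.
  have -> : s *: e = (z0 + s *: e) - z0 by rewrite addrAC subrr add0r.
  by apply: (le_trans (ler_normB _ _)); rewrite lerD// KD.
have supS : has_sup S by split; [exists 0 | exists ((D + D) / `|e|)].
have s0 : 0 <= sup S by apply: ub_le_sup => //; case: supS.
exists (sup S) => //; split; last first.
  move=> /nbhs_ballP[r /= r0 Hr].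
  have : S (sup S + r / 2 / `|e|).
    split; first by rewrite addr_ge0// !divr_ge0// ltW.
    apply: Hr; rewrite -ball_normE /ball_ /= scalerDl.
    rewrite [X in `|X|](_ : _ = - ((r / 2 / `|e|) *: e)); last first.
      by move: (_ *: e) (_ *: e) => *; ring.
    rewrite normrN Rcomplex_normrZ ger0_norm ?divr_ge0// ?divr_ge0 ?ltW//.
    by rewrite divfK ?gt_eqF//; lra.
  move=> /(ub_le_sup supS.2); rewrite gerDl leNgt.
  by rewrite !divr_gt0.
move=> B /nbhs_ballP[r /= r0 Hr].
have re0 : 0 < r / `|e| by rewrite divr_gt0.
have [s [s0' Ks] ss] := sup_adherent re0 supS.
have ssup : s <= sup S by apply: ub_le_sup => //; case: supS.
exists (z0 + s *: e); split => //; apply: Hr.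
rewrite -ball_normE /ball_ /=.
have -> : z0 + sup S *: e - (z0 + s *: e) = (sup S - s) *: e.
  by rewrite scalerBl; move: (_ *: e) (_ *: e) => *; ring.
rewrite Rcomplex_normrZ ger0_norm ?subr_ge0// -ltr_pdivlMr//; lra.
Qed.

Lemma cos_ge_cos1 (R : realType) (x : R) : -1 <= x -> x <= 1 -> cos 1 <= cos x.
Proof.
move=> x0 x1.
have -> : cos x = cos `|x|.
  by have [/ger0_norm ->//|/ltr0_norm ->] := leP 0 x; rewrite cosN.
have pi2 := pi_ge2 R.
have ax : `|x| <= 1 by rewrite ler_norml x0.
rewrite leNgt ltr_cos ?in_itv/= ?normr_ge0 -?leNgt//=; lra.
Qed.

Lemma sin_ge_cos1 (R : realType) (x : R) : 0 <= x -> x <= 1 ->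
  x * cos 1 <= sin x.
Proof.
move=> x0 x1.
have [|y] := @MVT_segment R sin cos 0 x x0 (fun y _ => is_derive_sin y).
  by apply: continuous_subspaceT; exact: continuous_sin.
rewrite in_itv/= sin0 !subr0 => /andP[y0 yx] ->.
by rewrite mulrC ler_wpM2r// cos_ge_cos1//; lra.
Qed.

Lemma tangent_angle_period (R : realType) (L : R) (g : R -> C R)
    (alpha : R -> R) : 0 < L -> tangent_angle L g alpha ->
  forall t, alpha (t + L) = alpha t + 2 * pi.
Proof.
move=> L0 [_ + _] t => /(_ t).
have -> : 2 * pi / L * (t + L) = 2 * pi / L * t + 2 * pi.
  by field; rewrite gt_eqF.
lra.
Qed.

Lemma exists_period_shift (R : realType) (L : R) (t s : R) : 0 < L ->
  exists n : int, s <= t + n%:~R * L /\ t + n%:~R * L < s + L.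
Proof.
move=> L0; exists (- Num.floor ((t - s) / L)).
have h1 := floor_le_tmp ((t - s) / L).
have h2 := floorD1_gt ((t - s) / L).
rewrite ler_pdivlMr// in h1; rewrite ltr_pdivrMr// intrD in h2.
rewrite mulrNz; move: (_%:~R) h1 h2 => x h1 h2; split; lra.
Qed.

Lemma periodic_int (R : realType) (V : Type) (L : R) (g : R -> V) :
  (forall t, g (t + L) = g t) -> forall (n : int) t, g (t + n%:~R * L) = g t.
Proof.
move=> gL.
have H (n : nat) t : g (t + n%:R * L) = g t.
  elim: n t => [|n IH] t; first by rewrite mul0r addr0.
  by rewrite -natr1 mulrDl mul1r addrA gL IH.
case=> n t; first exact: H.
by rewrite -[LHS](H n.+1) NegzE mulrNz mulNr subrK.
Qed.

Section support.
Variables (R : realType) (K : set (C R)) (L : R) (g : R -> C R)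
  (alpha : R -> R).
Hypotheses (KK : compact_convex_domain K) (Kg : arclength_parametrization K L g)
  (ga : tangent_angle L g alpha).

Let L_gt0 : 0 < L. Proof. by case: Kg. Qed.

Lemma curve_in t : K (g t).
Proof.
apply: (boundary_sub KK); case: Kg => _ gL [_ <-] _ _.
have [n [n0 nL]] := exists_period_shift t 0 L_gt0.
rewrite add0r in nL; exists (t + n%:~R * L).
  by rewrite /= in_itv/= n0.
exact: periodic_int.
Qed.

Lemma boundary_curve z s : boundary K z -> exists2 u, s <= u < s + L & g u = z.
Proof.
case: Kg => _ gL [_ <-] _ _ [t _ <-].
have [n [n0 nL]] := exists_period_shift t s L_gt0.
exists (t + n%:~R * L); first by rewrite n0.
exact: periodic_int.
Qed.

(** A line through a point of the curve whose direction lies between the two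
    one-sided tangent directions there is a supporting line of the domain. *)
Lemma support_line th s z :
  (forall u, u < s -> alpha u <= th) -> (forall u, s < u -> th <= alpha u) ->
  K z -> height th (g s) <= height th z.
Proof.
move=> lth gth Kz; have [_ gL _ _ _] := Kg.
have aL := tangent_angle_period L_gt0 ga.
have [amono _ _] := ga.
(* from [s] on, the height increases until the tangent has turned by [pi], and
   then decreases back to its initial value at [s + L] *)
have onb u : s <= u -> u < s + L -> height th (g s) <= height th (g u).
  move=> su uL; have [au|au] := leP (alpha u) (th + pi).
    have := functional_increment_ge (c := 0) Kg ga (heightB th) (heightZ th)
      (height_le th) su.
    rewrite mul0r subr_ge0; apply=> t st tu; rewrite height_unit_dir.
    apply: sin_ge0_pi; have := gth _ st; have := amono _ _ (ltW tu); lra.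
  have := @functional_increment_ge _ _ _ _ _ (fun z => - height th z) u
    (s + L) 0 Kg ga.
  rewrite mul0r gL opprK [X in 0 <= X]addrC subr_ge0; apply.
  - by move=> x y; rewrite heightB opprB opprK addrC.
  - by move=> x y; rewrite heightZ mulrN.
  - by move=> x; rewrite normrN height_le.
  - exact: ltW.
  move=> t ut tL; rewrite height_unit_dir.
  have h1 : alpha u <= alpha t by apply: amono; exact: ltW.
  have h2 : alpha t <= th + 2 * pi.
    by rewrite -[t](subrK L) aL lerD2r lth// ltrBlDr.
  have -> : alpha t - th = (alpha t - th - pi) + pi by rewrite subrK.
  by rewrite sinDpi opprK; apply: sin_ge0_pi; lra.
(* an interior point is above the boundary point under it *)
have e0 : unit_dir (th - pi / 2) != 0.
  by rewrite -normr_eq0 norm_unit_dir oner_eq0.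
have [r r0 Br] := ray_boundary KK Kz e0.
have [u /andP[su uL] gu] := boundary_curve s Br.
have := onb u su uL; rewrite gu heightD heightZ height_unit_dir.
have -> : th - pi / 2 - th = - (pi / 2) by ring.
by rewrite sinN sin_pihalf; lra.
Qed.

Lemma support_line_angle t z : K z -> 0 <= height (alpha t) (z - g t).
Proof.
move=> Kz; rewrite heightB subr_ge0; apply: support_line => //.
  by move=> u ut; case: ga => H _ _; apply: H; exact: ltW.
by move=> u ut; case: ga => H _ _; apply: H; exact: ltW.
Qed.

(** If the tangent has turned by [th] beyond [w], the part of the domain lying
    forward of [t] is raised above the tangent at [t]. *)
Lemma forward_height th t w z : 0 < th -> th <= 1 -> t <= w ->
  (forall u, w < u -> alpha t + th <= alpha u) -> K z ->
  (along (alpha t) (z - g t) - (w - t)) * sin th <=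
  height (alpha t) (z - g t).
Proof.
move=> th0 th1 tw Hw Kz; have [amono _ _] := ga.
(* the supporting line of direction [alpha t + th] touches the curve between [t]
   and [w] *)
pose S := [set u | alpha u < alpha t + th].
have St : S t by rewrite /S/= ltrDl.
have uS : ubound S w.
  by move=> u Su; rewrite leNgt; apply/negP => /Hw; rewrite leNgt Su.
have supS : has_sup S by split; [exists t | exists w].
have ts : t <= sup S by apply: ub_le_sup => //; exists w.
have sw : sup S <= w by apply: ge_sup => //; exists t.
have h1 : height (alpha t + th) (g (sup S)) <= height (alpha t + th) z.
  apply: support_line => // u.
    rewrite -subr_gt0 => us; have [v Sv] := sup_adherent us supS.
    by rewrite subKr => uv; apply: (le_trans (amono _ _ (ltW uv))); exact: ltW.
  move=> us; rewrite leNgt; apply/negP => Su.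
  by move: us; rewrite ltNge; apply/negP; rewrite negbK ub_le_sup//; exists w.
have h2 := support_line_angle t (curve_in (sup S)).
have h3 : along (alpha t) (g (sup S) - g t) <= w - t.
  apply: le_trans (ler_norm _) _; apply: le_trans (along_le _ _) _.
  by apply: le_trans (arclength_lipschitz Kg ts) _; rewrite lerD2r.
have h4 := support_line_angle t Kz.
have {h1} : height (alpha t + th) (g (sup S) - g t) <=
    height (alpha t + th) (z - g t) by rewrite !heightB lerD2r.
rewrite !height_rotate.
have c0 : 0 <= cos th.
  by apply: le_trans (ltW (cos1_gt0 R)) _; apply: cos_ge_cos1; lra.
have c1 : cos th <= 1 by exact: cos_le1.
have s0 : 0 <= sin th.
  apply: le_trans (sin_ge_cos1 (ltW th0) th1).
  by rewrite mulr_ge0// ltW// cos1_gt0.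
move: h2 h3 h4; move: (cos th) (sin th) c0 c1 s0 => c s c0 c1 s0.
move: (height _ (g _ - _)) (height _ (z - _)) => b y b0.
move: (along _ (g _ - _)) (along _ (z - _)) => a x aw y0 H.
have h5 : 0 <= (w - t - a) * s by rewrite mulr_ge0// subr_ge0.
have h6 : 0 <= y * (1 - c) by rewrite mulr_ge0// subr_ge0.
have h7 : 0 <= b * c by rewrite mulr_ge0.
lra.
Qed.

(** The mirror image of [forward_height]. *)
Lemma backward_height th t w z : 0 < th -> th <= 1 -> w <= t ->
  (forall u, u < w -> alpha u <= alpha t - th) -> K z ->
  (- along (alpha t) (z - g t) - (t - w)) * sin th <=
  height (alpha t) (z - g t).
Proof.
move=> th0 th1 wt Hw Kz; have [amono _ _] := ga.
pose S := [set u | alpha u <= alpha t - th].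
have S0 : S !=set0 by exists (w - 1); apply: Hw; lra.
have uS : ubound S t.
  move=> u Su; rewrite leNgt; apply/negP => /ltW/amono.
  by rewrite leNgt (le_lt_trans Su)// gtrBl.
have supS : has_sup S by split => //; exists t.
have st : sup S <= t by apply: ge_sup.
have ws : w <= sup S.
  rewrite leNgt; apply/negP => sw.
  have : (sup S + w) / 2 <= sup S.
    by apply: ub_le_sup; [exists t|apply: Hw; lra].
  lra.
have h1 : height (alpha t - th) (g (sup S)) <= height (alpha t - th) z.
  apply: support_line => // u.
    rewrite -subr_gt0 => us; have [v Sv] := sup_adherent us supS.
    by rewrite subKr => uv; apply: (le_trans (amono _ _ (ltW uv))).
  move=> us; rewrite leNgt; apply/negP => /ltW Su.
  by move: us; rewrite ltNge; apply/negP; rewrite negbK ub_le_sup//; exists t.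
have h2 := support_line_angle t (curve_in (sup S)).
have h3 : - along (alpha t) (g (sup S) - g t) <= t - w.
  apply: le_trans (ler_norm _) _; rewrite normrN.
  apply: le_trans (along_le _ _) _; rewrite distrC.
  by apply: le_trans (arclength_lipschitz Kg st) _; rewrite lerB.
have h4 := support_line_angle t Kz.
have {h1} : height (alpha t - th) (g (sup S) - g t) <=
    height (alpha t - th) (z - g t) by rewrite !heightB lerD2r.
rewrite !height_rotate cosN sinN.
have c0 : 0 <= cos th.
  by apply: le_trans (ltW (cos1_gt0 R)) _; apply: cos_ge_cos1; lra.
have c1 : cos th <= 1 by exact: cos_le1.
have s0 : 0 <= sin th.
  apply: le_trans (sin_ge_cos1 (ltW th0) th1).
  by rewrite mulr_ge0// ltW// cos1_gt0.
move: h2 h3 h4; move: (cos th) (sin th) c0 c1 s0 => c s c0 c1 s0.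
move: (height _ (g _ - _)) (height _ (z - _)) => b y b0.
move: (along _ (g _ - _)) (along _ (z - _)) => a x aw y0 H.
have h5 : 0 <= (t - w + a) * s by rewrite mulr_ge0//; lra.
have h6 : 0 <= y * (1 - c) by rewrite mulr_ge0// subr_ge0.
have h7 : 0 <= b * c by rewrite mulr_ge0.
lra.
Qed.

(** The perimeter is controlled by the diameter: along one of the eight arcs of
    length [L / 8] the tangent turns by at most 1. *)
Lemma perimeter_le d : (forall z w, K z -> K w -> `|z - w| <= d) ->
  L * cos 1 <= 8 * d.
Proof.
move=> Hd; have [amono _ _] := ga.
have aL := tangent_angle_period L_gt0 ga 0.
pose x i := i%:R * (L / 8).
have [i Hi] : exists i, alpha (x i.+1) - alpha (x i) <= 1.
  (* otherwise the total turning, which is [2 * pi], would exceed 8 *)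
  apply: contrapT => /forallNP H.
  have {}H i : 1 < alpha (x i.+1) - alpha (x i) by rewrite ltNge; apply/negP.
  have := H 0; have := H 1; have := H 2; have := H 3; have := H 4.
  have := H 5; have := H 6; have := H 7.
  have -> : x 8 = 0 + L by rewrite /x add0r mulrC divfK.
  have -> : x 0 = 0 by rewrite /x mul0r.
  rewrite aL; have := pihalf_lt2 R; lra.
have xi : x i <= x i.+1.
  by rewrite /x ler_wpM2r ?ler_nat// divr_ge0// ltW.
have := functional_increment_ge (c := cos 1) Kg ga (alongB (alpha (x i)))
  (alongZ _) (along_le _) xi.
have Hx : x i.+1 - x i = L / 8 by rewrite /x -natr1; ring.
have H1 : `|g (x i.+1) - g (x i)| <= d by apply: Hd; exact: curve_in.
rewrite Hx -alongB => H2.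
have : cos 1 * (L / 8) <= along (alpha (x i)) (g (x i.+1) - g (x i)).
  apply: H2 => t it ti; rewrite along_unit_dir.
  have h1 := amono _ _ (ltW it); have h2 := amono _ _ (ltW ti).
  by apply: cos_ge_cos1; lra.
have := le_trans (ler_norm _) (along_le (alpha (x i)) (g (x i.+1) - g (x i))).
lra.
Qed.

End support.

(** * Turning of the tangent *)

Lemma norm_sin_le (R : realType) (x : R) : `|sin x| <= `|x|.
Proof.
suff H (y : R) : 0 <= y -> `|sin y| <= y.
  have [x0|x0] := leP 0 x; first by rewrite (ger0_norm x0) H.
  by rewrite (ltr0_norm x0) -normrN -sinN H// oppr_ge0 ltW.
move=> y0.
have [|z _] := @MVT_segment R sin cos 0 y y0 (fun z _ => is_derive_sin z).
  by apply: continuous_subspaceT; exact: continuous_sin.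
rewrite sin0 !subr0 => ->; rewrite normrM (ger0_norm y0).
by rewrite ler_piMl// cos_max.
Qed.

Lemma unit_dir_lipschitz (R : realType) (a b : R) :
  `|unit_dir a - unit_dir b| <= `|a - b|.
Proof.
rewrite -(@ler_pXn2r _ 2)// ?nnegrE// (norm_frame b) alongB heightB.
rewrite !along_unit_dir !height_unit_dir subrr cos0 sin0 subr0.
have h : a - b = (a - b) / 2 + (a - b) / 2 by field.
set y := (a - b) / 2 in h.
have := norm_sin_le y; have := cos2Dsin2 y; have := cos2Dsin2 (a - b).
have -> : cos (a - b) = cos y ^+ 2 - sin y ^+ 2 by rewrite h cosD; ring.
move=> h1 h2 h3.
have h4 : sin y ^+ 2 <= y ^+ 2.
  rewrite -[sin y ^+ 2]real_normK ?num_real//.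
  by rewrite -[y ^+ 2]real_normK ?num_real// lerXn2r ?nnegrE.
have -> : `|a - b| ^+ 2 = 4 * y ^+ 2.
  by rewrite real_normK ?num_real// /y; field.
nra.
Qed.

Lemma negligible_complement_dense (R : realType) (N : set R) (c d : R) :
  (@lebesgue_measure R).-negligible N -> c < d ->
  exists2 v, c < v < d & ~ N v.
Proof.
move=> negN cd; apply: contrapT => H.
have : (@lebesgue_measure R).-negligible `]c, d[%classic.
  apply: negligibleS negN => v /=; rewrite in_itv/= => cvd.
  by apply: contrapT => Nv; apply: H; exists v.
move=> [A [mA A0 sA]].
have : (lebesgue_measure `]c, d[%classic <= 0)%E.
  rewrite -A0; apply: le_measure sA; rewrite inE//.
rewrite lebesgue_measure_itv/= lte_fin cd -EFinB lee_fin.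
by rewrite subr_le0 leNgt cd.
Qed.

(** The curvature exists at [t] and is at least [kappa]. *)
Definition curvature_ge (R : realType) (kappa : R) (g : R -> C R) (t : R) :=
  exists2 w, is_second_derivative g t w & kappa <= `|w|.

(** On a set where the curvature is at least [kappa] almost everywhere the
    tangent angle grows at rate at least [kappa]. *)
Lemma turning_ge_curvature (R : realType) (L : R) (g : R -> C R)
    (alpha : R -> R) (kappa a b : R) (N : set R) :
  tangent_angle L g alpha -> (@lebesgue_measure R).-negligible N -> a <= b ->
  (forall t, a < t -> t < b -> ~ N t -> curvature_ge kappa g t) ->
  kappa * (b - a) <= alpha b - alpha a.
Proof.
move=> [amono _ negG] negN ab Hc.
pose Bad : set R := ~` [set t : R | is_derive t 1 g (unit_dir (alpha t))].
have negB : (@lebesgue_measure R).-negligible Bad by exact: negG.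
apply: (@increment_ge_ae _ alpha a b kappa 0 (N `|` Bad) ab) => //.
- exact: negligibleU.
- by move=> s t st; rewrite oppr0 mul0r subr_ge0 amono.
move=> t at_ tb NBt e e0.
have Nt : ~ N t by move=> ?; apply: NBt; left.
have Gt : is_derive t 1 g (unit_dir (alpha t)).
  by apply: contrapT => ?; apply: NBt; right.
have [w [dgt Hw] kw] := Hc _ at_ tb Nt.
have /cvgrPdist_le/(_ e e0) := Hw.
rewrite !near_withinE => /nbhs_ballP[r /= r0 Hr].
have dE (v : R) : is_derive v 1 g (unit_dir (alpha v)) ->
    derive1 g v = unit_dir (alpha v).
  by move=> [_ <-]; rewrite derive1E.
(* At the points where [alpha] is the tangent angle the turning is at least a
   chord of the unit circle.  These points are dense and [alpha] is monotone, so
   the bound extends to all points. *)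
have key h : `|h| < r -> ~ Bad (t + h) ->
    (kappa - e) * `|h| <= `|alpha (t + h) - alpha t|.
  move=> hr Bh; have [->|h0] := eqVneq h 0.
    by rewrite normr0 mulr0.
  have Gh : is_derive (t + h) 1 g (unit_dir (alpha (t + h))) by exact: contrapT.
  have := Hr h; rewrite -ball_normE /= sub0r normrN => /(_ hr h0).
  have [dgh _] := Gh => /(_ dgh); rewrite !dE// => H.
  have H1 : kappa - e <=
      `|h^-1 *: (unit_dir (alpha (t + h)) - unit_dir (alpha t))|.
    set X := h^-1 *: _ in H *.
    by have := ler_normD (w - X) X; rewrite subrK; lra.
  apply: le_trans (unit_dir_lipschitz _ _); move: H1.
  by rewrite Rcomplex_normrZ normfV ler_pdivlMl ?normr_gt0// mulrC.
have fwd u : t <= u -> u < t + r -> (kappa - e) * (u - t) <= alpha u - alpha t.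
  move=> tu ur; have au := amono _ _ tu.
  have [k0|k0] := leP (kappa - e) 0.
    have : 0 <= - (kappa - e) * (u - t) by apply: mulr_ge0; lra.
    lra.
  have [tu'|] := ltP t u; last first.
    by move=> ut; have -> : u = t; [lra|rewrite !subrr mulr0].
  apply/ler_addgt0Pr => eta eta0.
  pose c := Num.max t (u - eta / (kappa - e)).
  have cu : c < u by rewrite gt_max tu' gtrBl divr_gt0.
  have [v /andP[cv vu] Bv] := negligible_complement_dense negB cu.
  move: cv; rewrite gt_max => /andP[tv cv].
  have := key (v - t); rewrite subrKC => /(_ _ Bv).
  have av := amono _ _ (ltW tv); have av' := amono _ _ (ltW vu).
  rewrite !ger0_norm ?subr_ge0//; last exact: ltW.
  move=> H; have {}H : (kappa - e) * (v - t) <= alpha v - alpha t.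
    by apply: H; lra.
  have : (kappa - e) * (u - v) <= eta by rewrite -ler_pdivlMl// mulrC; lra.
  lra.
have bwd u : u <= t -> t - r < u -> (kappa - e) * (t - u) <= alpha t - alpha u.
  move=> tu ur; have au := amono _ _ tu.
  have [k0|k0] := leP (kappa - e) 0.
    have : 0 <= - (kappa - e) * (t - u) by apply: mulr_ge0; lra.
    lra.
  have [tu'|] := ltP u t; last first.
    by move=> ut; have -> : u = t; [lra|rewrite !subrr mulr0].
  apply/ler_addgt0Pr => eta eta0.
  pose c := Num.min t (u + eta / (kappa - e)).
  have cu : u < c by rewrite lt_min tu' ltrDl divr_gt0.
  have [v /andP[vu cv] Bv] := negligible_complement_dense negB cu.
  move: cv; rewrite lt_min => /andP[tv cv].
  have := key (v - t); rewrite subrKC => /(_ _ Bv).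
  have av := amono _ _ (ltW tv); have av' := amono _ _ (ltW vu).
  rewrite distrC [X in _ <= X]distrC !ger0_norm ?subr_ge0//; last exact: ltW.
  move=> H; have {}H : (kappa - e) * (t - v) <= alpha t - alpha v.
    by apply: H; lra.
  have : (kappa - e) * (v - u) <= eta by rewrite -ler_pdivlMl// mulrC; lra.
  lra.
exists r => // s u ts st tu ut.
have := fwd u tu ut; have := bwd s st ts; lra.
Qed.

(** A corner contributes its whole outer angle to the turning. *)
Lemma outer_angle_le (R : realType) (alpha : R -> R) (s x u : R) :
  {homo alpha : s t / s <= t} -> s < x -> x < u ->
  outer_angle alpha x <= alpha u - alpha s.
Proof.
move=> am sx xu; rewrite /outer_angle; apply: lerB.
  apply: limr_le.
    apply: nondecreasing_at_right_is_cvgr.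
      by apply: filterE => y a b _ _; exact: am.
    apply: filterE => y; exists (alpha x) => _ /= [a + <-].
    by rewrite in_itv/= => /andP[xa _]; apply/am/ltW.
  by near=> y; apply: am; near: y; exact: nbhs_right_le.
apply: limr_ge.
  apply: nondecreasing_at_left_is_cvgr.
    by apply: filterE => y a b _ _; exact: am.
  apply: filterE => y; exists (alpha x) => _ /= [a + <-].
  by rewrite in_itv/= => /andP[_ ax]; apply/am/ltW.
by near=> y; apply: am; near: y; exact: nbhs_left_ge.
Unshelve. all: by end_near. Qed.

Section breakpoints.
Variables (R : realType) (v : nat -> R) (k : nat) (L : R).
Hypotheses (L_gt0 : 0 < L) (v_incr : forall j, v j < v j.+1)
  (v_period : forall j, v (j + k)%N = v j + L).

Lemma breakpoint_le i j : (i <= j)%N -> v i <= v j.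
Proof.
move=> /subnK <-; elim: (j - i)%N => // n IH.
by rewrite addSn (le_trans IH)// ltW.
Qed.

Lemma breakpoint_unbounded x : exists n, x < v n.
Proof.
have vn n : v (n * k)%N = v 0%N + n%:R * L.
  elim: n => [|n IH]; first by rewrite mul0r addr0.
  by rewrite mulSn addnC v_period IH -natr1; ring.
exists ((Num.truncn `|(x - v 0%N) / L|).+1 * k)%N.
rewrite vn -ltrBlDl -ltr_pdivrMr//.
by apply: le_lt_trans (ler_norm _) _; exact: truncnS_gt.
Qed.

Lemma breakpoint_locate x : v 0%N <= x -> exists j, v j <= x /\ x < v j.+1.
Proof.
move=> v0x; have [n] := ex_minnP (breakpoint_unbounded x).
case: n => [|n] xn Hn; first by move: v0x; rewrite leNgt xn.
exists n; split => //; rewrite leNgt; apply/negP => /Hn.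
by rewrite ltnn.
Qed.

Lemma breakpoint_locate_left x : v 0%N < x ->
  exists j, v j < x /\ x <= v j.+1.
Proof.
move=> v0x; have [y [vy yv]] := breakpoint_locate (ltW v0x).
have [|vx] := eqVneq (v y) x; last first.
  by exists y; split; [rewrite lt_neqAle vx | exact: ltW].
case: y vy yv => [|y] vy yv vx; first by move: v0x; rewrite vx ltxx.
by exists y; rewrite -vx.
Qed.

End breakpoints.

Section turning.
Variables (R : realType) (L : R) (g : R -> C R) (alpha : R -> R) (v : nat -> R)
  (k : nat) (kappa xi : R) (straight : nat -> Prop).
Hypotheses (L_gt0 : 0 < L) (xi_gt0 : 0 < xi)
  (ga : tangent_angle L g alpha)
  (v_incr : forall j, v j < v j.+1) (v_period : forall j, v (j + k)%N = v j + L)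
  (pieces : forall j, curved_piece kappa g (v j) (v j.+1) \/ straight j)
  (corners : forall j, (`[< straight j >] + `[< straight j.+1 >])%N%:R * xi
     <= outer_angle alpha (v j.+1)).

(** The corner at an end of a straight piece. *)
Lemma straight_corner j s u : straight j \/ straight j.+1 ->
  s < v j.+1 -> v j.+1 < u -> xi <= alpha u - alpha s.
Proof.
move=> Hj sv vu; have [amono _ _] := ga.
apply: le_trans (outer_angle_le amono sv vu); apply: le_trans (corners j).
apply: ler_peMl; first exact: ltW.
by rewrite (ler_nat _ 1); case: Hj => /asboolP ->; rewrite ?addn1.
Qed.

(* the exceptional points of the curved pieces *)
Let uncurved := [set t : R | exists2 j, curved_piece kappa g (v j) (v j.+1) &
  t \in `[v j, v j.+1] /\ ~ curvature_ge kappa g t].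

Lemma negligible_uncurved : (@lebesgue_measure R).-negligible uncurved.
Proof.
pose F j := [set t : R | curved_piece kappa g (v j) (v j.+1) /\
   (t \in `[v j, v j.+1] /\ ~ curvature_ge kappa g t)].
have -> : uncurved = \bigcup_j F j.
  apply/seteqP; split => [t [j cj tj]|t [j _ [cj tj]]].
    by exists j.
  by exists j.
apply: negligible_bigcup => j.
have [cj|ncj] := pselect (curved_piece kappa g (v j) (v j.+1)).
  apply: negligibleS cj => t [_ [tj nt]] /= H.
  by apply: nt; exact: H.
apply: negligibleS (negligible_set0 _) => t [cj _].
by apply: ncj.
Qed.

(** Turning along consecutive curved pieces. *)
Lemma turning_ge i j t u : t <= u -> v i <= t -> u <= v j.+1 ->
  (forall l, (i <= l <= j)%N -> curved_piece kappa g (v l) (v l.+1)) ->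
  kappa * (u - t) <= alpha u - alpha t.
Proof.
move=> tu it uj Hc.
apply: (turning_ge_curvature ga negligible_uncurved tu) => s ts su nU.
have [|l [ls sl]] := breakpoint_locate L_gt0 v_period (x := s).
  apply: le_trans (ltW ts); apply: le_trans it.
  exact: breakpoint_le.
apply: contrapT => nc; apply: nU; exists l; last first.
  by split => //; rewrite in_itv/= ls ltW.
apply: Hc; apply/andP; split; rewrite leqNgt; apply/negP => h.
  have := breakpoint_le v_incr h; lra.
have := breakpoint_le v_incr h; lra.
Qed.

(** Turning from a curved piece onwards: either only curved pieces follow, or
    the corner at the beginning of a straight piece is passed. *)
Lemma forward_turning i t u : curved_piece kappa g (v i) (v i.+1) ->
  v i < t -> t < v i.+1 -> t < u ->
  Num.min (kappa * (u - t)) xi <= alpha u - alpha t.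
Proof.
move=> ci it ti tu; rewrite ge_min.
have [|j [ju uj]] := breakpoint_locate_left L_gt0 v_incr v_period (x := u).
  by apply: le_lt_trans tu; apply: le_trans (ltW it); exact: breakpoint_le.
have [H|] := pselect (forall l, (i <= l <= j)%N ->
    curved_piece kappa g (v l) (v l.+1)).
  by rewrite (turning_ge _ _ _ H)//; exact: ltW.
move=> /existsNP[l /not_implyP[/andP[il lj] ncl]].
have {}il : (i < l)%N.
  by rewrite ltn_neqAle il andbT; apply/eqP => h; apply: ncl; rewrite -h.
case: l il lj ncl => // l il lj ncl.
have sl : straight l.+1 by case: (pieces l.+1).
rewrite (@straight_corner l)//; first by rewrite orbT.
- by right.
- exact: lt_le_trans (breakpoint_le v_incr il).
- exact: le_lt_trans (breakpoint_le v_incr lj) ju.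
Qed.

(** The mirror image of [forward_turning]. *)
Lemma backward_turning i t u : curved_piece kappa g (v i) (v i.+1) ->
  v i < t -> t < v i.+1 -> v 0%N <= u -> u < t ->
  Num.min (kappa * (t - u)) xi <= alpha t - alpha u.
Proof.
move=> ci it ti u0 ut; rewrite ge_min.
have [j [ju uj]] := breakpoint_locate L_gt0 v_period u0.
have [H|] := pselect (forall l, (j <= l <= i)%N ->
    curved_piece kappa g (v l) (v l.+1)).
  by rewrite (turning_ge _ _ _ H)//; exact: ltW.
move=> /existsNP[l /not_implyP[/andP[jl li] ncl]].
have {}li : (l < i)%N.
  by rewrite ltn_neqAle li andbT; apply/eqP => h; apply: ncl; rewrite h.
have sl : straight l by case: (pieces l).
rewrite (@straight_corner l)//; first by rewrite orbT.
- by left.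
- by apply: (lt_le_trans uj); apply: breakpoint_le.
- exact: le_lt_trans (breakpoint_le v_incr li) it.
Qed.

End turning.

(** * The domain seen from a boundary point *)

(** A rate of turning: for [0 < x <= d], [turning_rate d kappa xi * x] is at
    most [kappa * x / 2], [xi] and 1. *)
Definition turning_rate (R : realType) (d kappa xi : R) : R :=
  Num.min (kappa / 2) (Num.min xi 1 / d).

(** The inverse of the diameter of a circle that contains the domain and is
    tangent to it at a given point of a curved piece. *)
Definition curved_constant (R : realType) (d kappa xi : R) : R :=
  (2 / (turning_rate d kappa xi * cos 1) + d)^-1.

(** A lower bound for the height, seen from a point of a short piece with a
    corner at each end, of the distant points of the domain. *)
Definition short_constant (R : realType) (delta xi : R) : R :=
  let s := Num.min xi 1 * cos 1 in delta / 2 * s / (s + 1).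

Section constants.
Variables (R : realType) (d kappa xi delta : R).
Hypotheses (d0 : 0 < d) (kappa0 : 0 < kappa) (xi0 : 0 < xi)
  (delta0 : 0 < delta).

Lemma turning_rate_gt0 : 0 < turning_rate d kappa xi.
Proof. by rewrite lt_min !divr_gt0// lt_min xi0 ltr01. Qed.

Lemma curved_constant_gt0 : 0 < curved_constant d kappa xi.
Proof.
rewrite invr_gt0 addr_gt0// divr_gt0// mulr_gt0// ?cos1_gt0//.
exact: turning_rate_gt0.
Qed.

Lemma short_constant_gt0 : 0 < short_constant delta xi.
Proof.
have s0 : 0 < Num.min xi 1 * cos 1.
  by rewrite mulr_gt0// ?cos1_gt0// lt_min xi0 ltr01.
apply: divr_gt0; last exact: addr_gt0.
by apply: mulr_gt0 => //; exact: divr_gt0.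
Qed.

End constants.

Section points.
Variables (R : realType) (K : set (C R)) (L : R) (g : R -> C R) (alpha : R -> R)
  (v : nat -> R) (k : nat) (kappa xi d : R) (straight : nat -> Prop).
Hypotheses (KK : compact_convex_domain K) (Kg : arclength_parametrization K L g)
  (ga : tangent_angle L g alpha)
  (d_gt0 : 0 < d) (kappa_gt0 : 0 < kappa) (xi_gt0 : 0 < xi)
  (Kd : forall z w, K z -> K w -> `|z - w| <= d)
  (v_incr : forall j, v j < v j.+1) (v_period : forall j, v (j + k)%N = v j + L)
  (pieces : forall j, curved_piece kappa g (v j) (v j.+1) \/ straight j)
  (corners : forall j, (`[< straight j >] + `[< straight j.+1 >])%N%:R * xi
     <= outer_angle alpha (v j.+1)).

Let L_gt0 : 0 < L. Proof. by case: Kg. Qed.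

Let cos1 : 0 < cos 1 :> R. Proof. exact: cos1_gt0. Qed.

Let turning_angle x : 0 < x -> x <= d ->
  exists th, [/\ 0 < th, th <= 1, th <= xi, th <= kappa * x / 2 &
    turning_rate d kappa xi * x * cos 1 <= sin th].
Proof.
move=> x0 xd; exists (Num.min (kappa * x / 2) (Num.min xi 1)).
set th := Num.min _ _.
have th0 : 0 < th by rewrite !lt_min divr_gt0 ?mulr_gt0//= xi_gt0 ltr01.
have th1 : th <= 1 by rewrite !ge_min lexx !orbT.
split => //; [by rewrite !ge_min lexx !orbT|by rewrite ge_min lexx|].
apply: le_trans (sin_ge_cos1 (ltW th0) th1); apply: ler_wpM2r; first exact: ltW.
rewrite le_min; apply/andP; split.
  rewrite mulrAC ler_wpM2r//; first exact: ltW.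
  by rewrite ge_min lexx.
have m0 : 0 < Num.min xi 1 by rewrite lt_min xi_gt0 ltr01.
apply: (@le_trans _ _ (Num.min xi 1 / d * x)).
  apply: ler_wpM2r; first exact: ltW.
  by rewrite /turning_rate ge_min lexx orbT.
by rewrite mulrAC ler_pdivrMr// ler_wpM2l// ltW.
Qed.

(** Points of a curved piece: the domain lies inside a circle, of radius
    controlled by the data, tangent there. *)
Lemma curved_point i t z : curved_piece kappa g (v i) (v i.+1) ->
  v i < t -> t < v i.+1 -> v 0%N <= t - d -> K z ->
  curved_constant d kappa xi * `|z - g t| ^+ 2 <= height (alpha t) (z - g t).
Proof.
move=> ci it ti td Kz; have [amono _ _] := ga.
have Kt := curve_in KK Kg t.
have zd : `|z - g t| <= d by exact: Kd.
have y0 := support_line_angle KK Kg ga t Kz.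
rewrite (norm_frame (alpha t)).
have ylt : height (alpha t) (z - g t) <= d.
  by apply: le_trans (ler_norm _) _; apply: le_trans (height_le _ _) _.
have xlt : `|along (alpha t) (z - g t)| <= d.
  exact: le_trans (along_le _ _) _.
have rate0 := turning_rate_gt0 d_gt0 kappa_gt0 xi_gt0.
set r := turning_rate d kappa xi in rate0.
(* supporting lines touching the curve at half of the horizontal distance *)
have key : r * cos 1 / 2 * along (alpha t) (z - g t) ^+ 2 <=
    height (alpha t) (z - g t).
  have [x0|x0|->] := ltgtP (along (alpha t) (z - g t)) 0; last first.
  - by rewrite expr0n mulr0.
  - rewrite gtr0_norm// in xlt.
    have [th [th0 th1 thxi thk sth]] := turning_angle x0 xlt.
    set x := along _ _ in x0 xlt thk sth *.
    have tw : t <= t + x / 2 by lra.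
    have := @forward_height _ _ _ _ _ KK Kg ga th t (t + x / 2) z th0 th1 tw.
    rewrite -/x => /(_ _ Kz) H; apply: le_trans (H _).
      have -> : x - (t + x / 2 - t) = x / 2 by field.
      have -> : r * cos 1 / 2 * x ^+ 2 = x / 2 * (r * x * cos 1) by ring.
      by rewrite ler_wpM2l//; lra.
    move=> u wu; have tu : t < u by lra.
    have := forward_turning L_gt0 xi_gt0 ga v_incr v_period pieces
      corners ci it ti tu.
    have : th <= Num.min (kappa * (u - t)) xi.
      rewrite le_min thxi andbT; apply: (le_trans thk).
      have -> : kappa * x / 2 = kappa * (x / 2) by ring.
      by rewrite ler_wpM2l ?ltW//; lra.
    lra.
  - rewrite ltr0_norm// in xlt.
    have x0' : 0 < - along (alpha t) (z - g t) by rewrite oppr_gt0.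
    have [th [th0 th1 thxi thk sth]] := turning_angle x0' xlt.
    rewrite -[along _ _ ^+ 2]sqrrN.
    set x := - along _ _ in x0' xlt thk sth *.
    have tw : t - x / 2 <= t by lra.
    have := @backward_height _ _ _ _ _ KK Kg ga th t (t - x / 2) z th0 th1 tw.
    rewrite -/x => /(_ _ Kz) H; apply: le_trans (H _).
      have -> : x - (t - (t - x / 2)) = x / 2 by field.
      have -> : r * cos 1 / 2 * x ^+ 2 = x / 2 * (r * x * cos 1) by ring.
      by rewrite ler_wpM2l//; lra.
    move=> u wu; pose u' := Num.max u (v 0%N).
    have uu' : alpha u <= alpha u' by apply: amono; rewrite le_max lexx.
    have u'w : u' < t - x / 2 by rewrite gt_max wu/=; lra.
    have u't : u' < t by lra.
    have v0u : v 0%N <= u' by rewrite le_max lexx orbT.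
    have := backward_turning L_gt0 xi_gt0 ga v_incr v_period pieces
      corners ci it ti v0u u't.
    have : th <= Num.min (kappa * (t - u')) xi.
      rewrite le_min thxi andbT; apply: (le_trans thk).
      have -> : kappa * x / 2 = kappa * (x / 2) by ring.
      by rewrite ler_wpM2l ?ltW//; lra.
    lra.
move: (along _ _) (height _ _) key y0 ylt => x y key y0 yd.
have q0 : 0 < r * cos 1 / 2 by rewrite divr_gt0// mulr_gt0.
rewrite /curved_constant -/r.
have -> : 2 / (r * cos 1) = (r * cos 1 / 2)^-1 by rewrite invf_div.
move: (r * cos 1 / 2) key q0 => q key q0.
rewrite mulrC ler_pdivrMr; last by rewrite addr_gt0// invr_gt0.
rewrite mulrDr lerD//; first by rewrite ler_pdivlMr// mulrC.
by rewrite expr2 ler_wpM2l.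
Qed.

(** Points of a short piece with a corner at each end: points of the domain
    that are far away are well above the tangent. *)
Lemma short_point i t z Delta delta : straight i.+1 ->
  v i.+2 - v i.+1 <= Delta - delta ->
  v i.+1 < t -> t < v i.+2 -> 0 < delta -> K z ->
  `|z - g t| <= Delta - delta / 2 \/
  short_constant delta xi <= height (alpha t) (z - g t).
Proof.
move=> si li it ti delta0 Kz; have [amono _ _] := ga.
have y0 := support_line_angle KK Kg ga t Kz.
pose th := Num.min xi 1.
have th0 : 0 < th by rewrite lt_min xi_gt0 ltr01.
have th1 : th <= 1 by rewrite ge_min lexx orbT.
have thxi : th <= xi by rewrite ge_min lexx.
pose s := th * cos 1.
have s0 : 0 < s by rewrite mulr_gt0.
have ssin : s <= sin th by apply: sin_ge_cos1 => //; exact: ltW.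
have Hf : (along (alpha t) (z - g t) - (v i.+2 - t)) * sin th <=
    height (alpha t) (z - g t).
  apply: (forward_height KK Kg ga th0 th1 (ltW ti)) => // u vu.
  have := straight_corner xi_gt0 ga corners (or_introl si) ti vu; lra.
have Hb : (- along (alpha t) (z - g t) - (t - v i.+1)) * sin th <=
    height (alpha t) (z - g t).
  apply: (backward_height KK Kg ga th0 th1 (ltW it)) => // u vu.
  have := straight_corner xi_gt0 ga corners (or_intror si) vu it; lra.
have nle : `|z - g t| <=
    `|along (alpha t) (z - g t)| + height (alpha t) (z - g t).
  have a0 : 0 <= `|along (alpha t) (z - g t)| + height (alpha t) (z - g t).
    exact: addr_ge0.
  rewrite -(@ler_pXn2r _ 2)// ?nnegrE// (norm_frame (alpha t)).
  move: (along _ _) (height _ _) y0 => x y y0.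
  have -> : x ^+ 2 = `|x| ^+ 2 by rewrite real_normK ?num_real.
  have := normr_ge0 x; nra.
have down x a : 0 <= height (alpha t) (z - g t) ->
    (x - a) * sin th <= height (alpha t) (z - g t) ->
    (x - a) * s <= height (alpha t) (z - g t).
  move=> h0 h1; have [xa|xa] := leP 0 (x - a).
    by apply: le_trans h1; rewrite ler_wpM2l.
  by apply: le_trans h0; rewrite mulr_le0_ge0// ltW.
have {}Hf := down _ _ y0 Hf; have {}Hb := down _ _ y0 Hb.
rewrite /short_constant -/th -/s.
move: (along _ _) (height _ _) nle y0 Hf Hb {down} => x y nle y0 Hf Hb.
have [h|h] := leP `|z - g t| (Delta - delta / 2); [by left|right].
rewrite ler_pdivrMr; last by rewrite addr_gt0.
have lx : (`|x| - (Delta - delta)) * s <= y.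
  have [x0|x0] := leP 0 x.
    apply: le_trans Hf; rewrite ler_wpM2r ?ltW//; rewrite ger0_norm//; lra.
  apply: le_trans Hb; rewrite ler_wpM2r ?ltW//; rewrite ltr0_norm//; lra.
have : (delta / 2 - y) * s <= (`|x| - (Delta - delta)) * s.
  by rewrite ler_wpM2r ?ltW//; lra.
lra.
Qed.

End points.

(** The domain seen from a boundary point [zeta] in the supporting direction
    [th]: either it is contained in a circle tangent there, or its points that
    are not within [r] of [zeta] are above the tangent by at least [eta]. *)
Definition seen_from (R : realType) (K : set (C R)) (zeta : C R)
    (th c r eta : R) : Prop :=
  (forall z, K z -> 0 <= height th (z - zeta)) /\
  ((forall z, K z -> c * `|z - zeta| ^+ 2 <= height th (z - zeta)) \/
   (forall z, K z -> `|z - zeta| <= r \/ eta <= height th (z - zeta))).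

(** The exceptional set consists of the breakpoints and their translates by
    periods. *)
Lemma E_domain_seen_from (R : realType) (k : nat) (d Delta kappa xi delta : R)
    (K : set (C R)) (L : R) (g : R -> C R) (alpha : R -> R) :
  0 < d -> 0 < kappa -> 0 < xi -> 0 < delta ->
  compact_convex_domain K -> arclength_parametrization K L g ->
  tangent_angle L g alpha ->
  E_domain k d Delta kappa xi delta K L g alpha ->
  (forall z w, K z -> K w -> `|z - w| <= d) ->
  exists2 N : set R, (@lebesgue_measure R).-negligible N &
    forall t, ~ N t -> exists th, seen_from K (g t) th
      (curved_constant d kappa xi) (Delta - delta / 2)
      (short_constant delta xi).
Proof.
move=> d0 kappa0 xi0 delta0 KK Kg ga [_ _ [v [vi vp pc cn]]] Kd.
have L0 : 0 < L by case: Kg.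
exists (\bigcup_j \bigcup_n [set v j - n%:R * L]).
  apply: negligible_bigcup => j; apply: negligible_bigcup => n.
  by apply/negligibleP; [exact: measurable_set1|exact: lebesgue_measure_set1].
move=> t Nt.
(* [t] is translated past [v 1], with enough room for the backward estimates *)
pose n := (Num.truncn `|(v 1%N + d - t) / L|).+1.
have hn : v 1%N + d <= t + n%:R * L.
  rewrite -lerBlDl -ler_pdivrMr//; apply: (le_trans (ler_norm _)).
  exact/ltW/truncnS_gt.
set t' := t + n%:R * L in hn.
have gt' : g t' = g t.
  by have := periodic_int (_ : forall t, g (t + L) = g t) n t; apply; case: Kg.
have v01 := vi 0%N.
have [|j [vj jv]] := breakpoint_locate L0 vp (x := t'); first by lra.
have {}vj : v j < t'.
  rewrite lt_neqAle vj andbT; apply/eqP => h; apply: Nt.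
  by exists j => //; exists n => //=; rewrite h /t' addrK.
exists (alpha t'); rewrite -gt'; split.
  by move=> z Kz; exact: support_line_angle KK Kg ga _ _ Kz.
case: (pc j) => [cj|sj].
  left=> z Kz.
  apply: (curved_point KK Kg ga d0 kappa0 xi0 Kd vi vp pc cn cj) => //.
  lra.
case: j sj vj jv => [|j] sj vj jv; first by lra.
right=> z Kz; have [_ lj] := sj.
exact: (short_point KK Kg ga xi0 cn sj lj vj jv delta0 Kz).
Qed.

(** Both sides are the imaginary part of [exp (i th) / (zeta - z)]. *)
Lemma height_inv (R : realType) (th : R) (z zeta : C R) : z != zeta ->
  height (- th) ((zeta - z)^-1) = height th (z - zeta) / `|z - zeta| ^+ 2.
Proof.
rewrite -subr_eq0 -(opprB z zeta) invrN => zz.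
have : `|z - zeta| ^+ 2 != 0 by rewrite expf_neq0// normr_eq0.
rewrite normRc_sqr; case: (z - zeta) => a b /= ab0.
rewrite /height cosN sinN.
change ((- (- (b / (a ^+ 2 + b ^+ 2)))) * cos th -
  (- (a / (a ^+ 2 + b ^+ 2))) * - sin th =
  (b * cos th - a * sin th) / (a ^+ 2 + b ^+ 2)).
by field.
Qed.

(** The logarithmic derivative is at least the imaginary part of its product
    with a number of modulus 1. *)
Lemma log_derivative_ge (R : realType) (rs : seq (C R)) (zeta : C R) (th : R) :
  zeta \notin rs ->
  \sum_(z <- rs) height th (z - zeta) / `|z - zeta| ^+ 2 <=
  `|\sum_(z <- rs) (zeta - z)^-1 : C R|.
Proof.
move=> zrs; apply: le_trans (height_le (- th) _); apply: le_trans (ler_norm _).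
have -> : height (- th) (\sum_(z <- rs) (zeta - z)^-1) =
    \sum_(z <- rs) height (- th) ((zeta - z)^-1).
  apply: (big_morph (height (- th))); first exact: heightD.
  by rewrite /height/= !mul0r subrr.
rewrite big_seq [leRHS]big_seq; apply: ler_sum => z zr.
by rewrite height_inv//; apply: contraNneq zrs => <-.
Qed.

Lemma prod_le_count (R : realType) (rs : seq (C R)) (zeta : C R) (r d : R) :
  0 <= r -> (forall z, z \in rs -> `|zeta - z| <= d) ->
  let m := count (fun z => r < `|zeta - z|) rs in
  \prod_(z <- rs) `|zeta - z| <= r ^+ (size rs - m) * d ^+ m.
Proof.
move=> r0; elim: rs => [|z rs IH] Hd /=; first by rewrite big_nil mulr1.
rewrite big_cons.
have {}IH := IH (fun x xr => Hd x (mem_behead (s := z :: rs) xr)).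
have dz : `|zeta - z| <= d by apply: Hd; rewrite mem_head.
have p0 : 0 <= \prod_(j <- rs) `|zeta - j| by rewrite prodr_ge0.
case: ltP => h /=.
  rewrite add1n subSS exprS [leRHS]mulrCA; exact: ler_pM.
rewrite add0n subSn ?count_size// exprS -[leRHS]mulrA; exact: ler_pM.
Qed.

(** At a point from which the domain is seen as above, a polynomial with all
    its zeros in the domain has a large derivative or is small: the first holds
    if at least [n / m] of the zeros are not within [r] of the point. *)
Lemma derivative_large_or_small (R : realType) (K : set (C R)) (zeta : C R)
    (th c1 r eta d rho c : R) (m n : nat) (p : {poly C R}) :
  seen_from K zeta th c1 r eta -> (forall z, K z -> `|zeta - z| <= d) ->
  0 < r -> 0 < eta -> 0 < d -> (0 < m)%N -> r < rho ->
  d / r <= (rho / r) ^+ m ->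
  0 <= c -> c <= c1 -> c <= eta / (m%:R * d ^+ 2) ->
  polys_zeros_in n K p ->
  c * n%:R * `|p.[zeta] : C R| <= `|p^`().[zeta] : C R| \/
  `|p.[zeta] : C R| <= `|lead_coef p : C R| * rho ^+ n.
Proof.
move=> [h0 Hs] Kd r0 eta0 d0 m0 rrho dm c0 cc1 ce [sp Kp].
have [rs pE] : exists rs : seq (C R),
    p = lead_coef p *: \prod_(z <- rs) ('X - z%:P).
  by have [rs pE] := closed_field_poly_normal p; exists rs.
have p0 : p != 0 by rewrite -size_poly_eq0 sp.
have lc0 : lead_coef p != 0 by rewrite lead_coef_eq0.
have srs : size rs = n.
  by have := sp; rewrite pE size_scale// size_prod_XsubC => -[].
have Krs z : z \in rs -> K z.
  by move=> zr; apply: Kp; rewrite pE rootZ// root_prod_XsubC.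
have [zrs|zrs] := boolP (zeta \in rs).
  left; have /rootP -> : root p zeta by rewrite pE rootZ// root_prod_XsubC.
  by rewrite normr0 mulr0.
have pzE : `|p.[zeta] : C R| =
    `|lead_coef p : C R| * \prod_(z <- rs) `|zeta - z|.
  rewrite {1}pE hornerZ normRcM; congr (_ * _).
  rewrite horner_prod normRc_prod; apply: eq_bigr => z _.
  by rewrite hornerXsubC.
have dpE : p^`().[zeta] = p.[zeta] * \sum_(z <- rs) (zeta - z)^-1.
  by rewrite {1 2}pE derivZ !hornerZ deriv_prod_XsubC// mulrA.
have big (S : R) : c * n%:R <= S ->
    S <= \sum_(z <- rs) height th (z - zeta) / `|z - zeta : C R| ^+ 2 ->
    c * n%:R * `|p.[zeta] : C R| <= `|p^`().[zeta] : C R|.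
  move=> h1 h2; rewrite dpE normRcM mulrC ler_wpM2l//.
  by apply: (le_trans h1); apply: (le_trans h2); exact: log_derivative_ge.
have nz (z : C R) : z \in rs -> 0 < `|z - zeta| ^+ 2.
  move=> zr; rewrite exprn_gt0// normr_gt0 subr_eq0.
  by apply: contraNneq zrs => <-.
case: Hs => [Hc|Hf].
  left; apply: (big (\sum_(z <- rs) c)).
    by rewrite big_const_seq count_predT iter_addr_0 srs mulr_natr.
  rewrite big_seq [leRHS]big_seq; apply: ler_sum => z zr.
  rewrite ler_pdivlMr ?nz//; apply: le_trans (Hc _ (Krs _ zr)).
  by rewrite ler_wpM2r.
set q := count (fun z => r < `|zeta - z|) rs.
have [nq|qn] := leqP n (m * q).
  left; apply: (big (\sum_(z <- rs | r < `|zeta - z|) eta / d ^+ 2)).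
    rewrite big_const_seq iter_addr_0 -/q.
    apply: (@le_trans _ _ (c * (m * q)%:R)).
      by rewrite ler_wpM2l// ler_nat.
    rewrite natrM mulrA -[leRHS]mulr_natr ler_wpM2r//.
    move: ce; rewrite ler_pdivlMr; last by rewrite mulr_gt0 ?ltr0n// exprn_gt0.
    by rewrite ler_pdivlMr ?exprn_gt0// mulrA.
  rewrite [leRHS](bigID (fun z => r < `|zeta - z|))/=.
  rewrite -[leLHS]addr0; apply: lerD; last first.
    rewrite big_seq_cond sumr_ge0// => z /andP[zr _].
    by apply: divr_ge0 => //; exact/h0/Krs.
  rewrite big_seq_cond [leRHS]big_seq_cond; apply: ler_sum => z /andP[zr rz].
  have hz : eta <= height th (z - zeta).
    by case: (Hf _ (Krs _ zr)) => //; rewrite distrC leNgt rz.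
  apply: ler_pM => //; [exact: ltW|by rewrite invr_ge0 exprn_ge0// ltW|].
  rewrite lef_pV2 ?posrE ?nz ?exprn_gt0//.
  by rewrite lerXn2r ?nnegrE ?(ltW d0)// distrC; exact/Kd/Krs.
right; rewrite pzE ler_wpM2l//.
apply: le_trans (prod_le_count (ltW r0) _) _.
  by move=> z zr; exact/Kd/Krs.
rewrite srs -/q.
have qn' : (q <= n)%N by rewrite -srs count_size.
have -> : r ^+ (n - q) * d ^+ q = r ^+ n * (d / r) ^+ q.
  rewrite -[in r ^+ n](subnK qn') exprD expr_div_n.
  by rewrite -mulrA; congr (_ * _); rewrite mulrC divfK// expf_neq0// gt_eqF.
have -> : rho ^+ n = r ^+ n * (rho / r) ^+ n.
  by rewrite expr_div_n mulrC divfK// expf_neq0// gt_eqF.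
apply: ler_wpM2l; first by rewrite exprn_ge0// ltW.
have dr0 : 0 <= d / r by rewrite divr_ge0// ltW.
apply: (@le_trans _ _ (((rho / r) ^+ m) ^+ q)).
  by rewrite lerXn2r ?nnegrE// (le_trans dr0).
rewrite -exprM ler_weXn2l//; first by rewrite ler_pdivlMr// mul1r ltW.
exact: ltnW.
Qed.

(** * Integral means over the boundary *)

Section power_integrals.
Variables (R : realType) (L q : R).
Hypotheses (L_gt0 : 0 < L) (q_ge1 : 1 <= q).
Let mu := @lebesgue_measure R.
Let q_gt0 : 0 < q. Proof. exact: lt_le_trans q_ge1. Qed.

Let muL : mu `[0, L]%classic = L%:E.
Proof. by rewrite /mu lebesgue_measure_itv/= lte_fin L_gt0 oppr0 adde0. Qed.

Lemma powR_measurable (h : R -> R) : continuous h ->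
  measurable_fun setT (fun t => h t `^ q).
Proof.
move=> ch; apply: (@measurableT_comp _ _ _ _ _ _ (fun x => x `^ q)) => //.
exact: continuous_measurable_fun.
Qed.

Lemma powR_integrable (h : R -> R) : continuous h -> (forall t, 0 <= h t) ->
  mu.-integrable `[0, L]%classic (EFin \o (fun t => h t `^ q)).
Proof.
move=> ch h0; apply: measurable_bounded_integrable => //.
- by rewrite [X in (X < _)%E]muL ltry.
- by apply: measurable_funTS; exact: powR_measurable.
have [c _ Hc] := EVT_max (ltW L_gt0) (continuous_subspaceT ch).
exists (h c `^ q); split; first by rewrite num_real.
move=> M hM t tL /=; rewrite ger0_norm ?powR_ge0//; apply: le_trans (ltW hM).
by rewrite ge0_ler_powR ?nnegrE ?(ltW q_gt0)// Hc.
Qed.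

Lemma integral_powR_ge (h : R -> R) (a b m : R) :
  continuous h -> (forall t, 0 <= h t) -> 0 <= m ->
  0 <= a -> a <= b -> b <= L -> (forall t, a <= t -> t <= b -> m <= h t) ->
  (b - a) * m `^ q <= \int[mu]_(t in `[0, L]) (h t `^ q).
Proof.
move=> ch h0 m0 a0 ab bL mh.
have sub : `[a, b]%classic `<=` `[0, L]%classic.
  move=> t /=; rewrite !in_itv/= => /andP[at_ tb].
  by rewrite (le_trans a0 at_) (le_trans tb bL).
have mab : mu `[a, b]%classic = (b - a)%:E.
  rewrite /mu lebesgue_measure_itv/= lte_fin; case: ltP => [//|ba].
  by congr EFin; lra.
have fin : (\int[mu]_(t in `[0%R, L]) (h t `^ q)%:E \is a fin_num)%E.
  exact: integrable_fin_num (powR_integrable ch h0).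
rewrite -lee_fin /Rintegral fineK//.
apply: (@le_trans _ _ (\int[mu]_(t in `[a, b]) (h t `^ q)%:E)%E); last first.
  apply: ge0_subset_integral => //.
    by apply/measurable_EFinP/measurable_funTS; exact: powR_measurable.
  by move=> t _; rewrite lee_fin powR_ge0.
apply: (@le_trans _ _ (\int[mu]_(t in `[a, b]) (m `^ q)%:E)%E).
  by rewrite integral_cst// [X in (_ * X)%E]mab -EFinM mulrC.
apply: ge0_le_integral => //.
- by move=> t _; rewrite lee_fin powR_ge0.
- by apply/measurable_EFinP/measurable_funTS; exact: powR_measurable.
move=> t /=; rewrite in_itv/= => /andP[at_ tb]; rewrite lee_fin.
by rewrite ge0_ler_powR ?nnegrE ?(ltW q_gt0)// mh.
Qed.

Lemma integral_powR_le (h1 h2 : R -> R) (s B : R) :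
  continuous h1 -> continuous h2 -> (forall t, 0 <= h1 t) ->
  (forall t, 0 <= h2 t) -> 0 <= s -> 0 <= B ->
  (forall t, h1 t <= s * h2 t \/ h1 t <= B) ->
  \int[mu]_(t in `[0, L]) (h1 t `^ q) <=
  s `^ q * \int[mu]_(t in `[0, L]) (h2 t `^ q) + L * B `^ q.
Proof.
move=> c1 c2 p1 p2 s0 B0 H.
have i1 := powR_integrable c1 p1; have i2 := powR_integrable c2 p2.
have i3 : mu.-integrable `[0, L]%classic
    (EFin \o (fun t => s `^ q * h2 t `^ q)).
  have -> : EFin \o (fun t => (s `^ q * h2 t `^ q)%R) =
      (fun t => ((s `^ q)%:E * (h2 t `^ q)%:E)%E).
    by apply/funext => t /=; rewrite EFinM.
  exact: (@integrableZl _ _ _ mu _ (measurable_itv _) (s `^ q)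
    (EFin \o (fun t => h2 t `^ q))).
have i4 : mu.-integrable `[0, L]%classic (EFin \o (fun=> B `^ q)).
  apply: measurable_bounded_integrable => //.
    by rewrite [X in (X < _)%E]muL ltry.
  exists (B `^ q); split; first by rewrite num_real.
  by move=> M hM t _ /=; rewrite ger0_norm ?powR_ge0// ltW.
have -> : s `^ q * \int[mu]_(t in `[0, L]) (h2 t `^ q) + L * B `^ q =
    \int[mu]_(t in `[0, L]) (s `^ q * h2 t `^ q + B `^ q).
  rewrite RintegralD//; congr (_ + _); first by rewrite RintegralZl.
  by rewrite Rintegral_cst// [X in fine X]muL mulrC.
apply: le_Rintegral => //.
  have -> : EFin \o (fun t => (s `^ q * h2 t `^ q + B `^ q)%R) =
      ((EFin \o (fun t => (s `^ q * h2 t `^ q)%R)) \+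
       (EFin \o (fun=> (B `^ q)%R)))%E.
    by apply/funext => t /=; rewrite EFinD.
  exact: (@integrableD _ _ _ mu _ (measurable_itv _) _ _ i3 i4).
move=> t _; have [h|h] := H t.
  apply: (@le_trans _ _ ((s * h2 t) `^ q)).
    by rewrite ge0_ler_powR ?nnegrE ?(ltW q_gt0)// mulr_ge0.
  by rewrite powRM// lerDl powR_ge0.
apply: (@le_trans _ _ (B `^ q)); last by rewrite lerDr mulr_ge0// powR_ge0.
by rewrite ge0_ler_powR ?nnegrE ?(ltW q_gt0).
Qed.

Lemma powR_root_le (I J H : R) : 0 <= I -> 0 <= J -> 0 <= H ->
  I <= H `^ q * J -> I `^ q^-1 <= H * J `^ q^-1.
Proof.
move=> I0 J0 H0 IHJ.
have qi0 : 0 <= q^-1 by rewrite invr_ge0 ltW.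
apply: (@le_trans _ _ ((H `^ q * J) `^ q^-1)).
  by rewrite ge0_ler_powR ?nnegrE// mulr_ge0// powR_ge0.
by rewrite powRM ?powR_ge0// -powRrM divff ?gt_eqF// powRr1.
Qed.

Lemma powR_ge_self (x : R) : 1 <= x -> x <= x `^ q.
Proof.
move=> x1; rewrite -{1}[x]powRr1; last by apply: le_trans x1.
by rewrite ler_powR.
Qed.

End power_integrals.

Lemma lipschitz_within_continuous (R : realType) (V : normedModType R)
    (A : set V) (h : V -> R) (M : R) :
  (forall x y, A x -> A y -> `|h x - h y| <= M * `|x - y|) ->
  {within A, continuous h}.
Proof.
move=> Hh; apply/subspace_continuousP => x Ax.
apply/cvgrPdist_le => e e0; rewrite near_withinE.
have N0 : 0 < `|M| + 1 by rewrite ltr_wpDl.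
near=> y => Ay; apply: (le_trans (Hh _ _ Ax Ay)).
have : `|x - y| <= e / (`|M| + 1).
  by near: y; apply: cvgr_dist_le => //; rewrite divr_gt0.
rewrite ler_pdivlMr// => h1; apply: le_trans h1.
rewrite mulrC; apply: ler_wpM2l => //.
by apply: le_trans (ler_norm M) _; rewrite lerDl.
Unshelve. all: by end_near. Qed.

Lemma poly_bounded (R : realType) (f : {poly C R}) (D : R) :
  exists M : R, forall z : C R, `|z| <= D -> `|f.[z] : C R| <= M.
Proof.
exists (\sum_(i < size f) `|f`_i : C R| * D ^+ i) => z zD.
rewrite horner_coef; apply: (le_trans (ler_norm_sum _ _ _)).
apply: ler_sum => i _; rewrite normRcM normRcX ler_wpM2l//.
by rewrite lerXn2r ?nnegrE// (le_trans _ zD).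
Qed.

Section diameter.
Variables (R : realType) (K : set (C R)).
Hypothesis KK : compact_convex_domain K.

Let bounded : has_ubound [set `|z.1 - z.2| | z in K `*` K].
Proof.
have [cK _ _] := KK; have [D _ HD] := compact_norm_bounded cK.
exists (D + D) => _ [[z w] [/= Kz Kw] <-].
by apply: (le_trans (ler_normB _ _)); rewrite lerD// HD.
Qed.

Lemma le_diameter z w : K z -> K w -> `|z - w| <= diameter K.
Proof. by move=> Kz Kw; apply: ub_le_sup => //; exists (z, w). Qed.

(** From any point, a set reaches out at least to a quarter of its diameter. *)
Lemma far_point z : 0 < diameter K -> K z ->
  exists2 w, K w & diameter K / 4 <= `|z - w|.
Proof.
move=> d0 Kz; set d := diameter K in d0 *.
have ne : [set `|z.1 - z.2| | z in K `*` K] !=set0 by exists `|z - z|, (z, z).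
have hd : d / 2 < sup [set `|z.1 - z.2| | z in K `*` K].
  by rewrite -[sup _]/d; lra.
have [_ [[x y] [/= Kx Ky] <-] dxy] := sup_gt ne hd.
have [h|h] := leP (d / 4) `|z - x|; first by exists x.
exists y => //.
have : `|x - y| <= `|z - x| + `|z - y|.
  have -> : x - y = - (z - x) + (z - y) by ring.
  by rewrite (le_trans (ler_normD _ _))// normrN.
lra.
Qed.

(** A Markov inequality on the domain, from the one on segments of length at
    least a quarter of the diameter. *)
Lemma markov_domain (f : {poly C R}) (m : nat) (M : R) z :
  0 < diameter K -> (size f <= m.+1)%N ->
  (forall w, K w -> `|f.[w] : C R| <= M) -> K z ->
  `|f^`().[z] : C R| <= 72%:R * m%:R ^+ 3 * M / diameter K.
Proof.
move=> d0 sf HM Kz; have [w Kw wz] := far_point d0 Kz.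
have := @markov_segment _ m f w z M sf.
have seg (u : R) : 0 <= u -> u <= 1 ->
    `|f.[w + (z - w) * ((u%:C)%C : C R)] : C R| <= M.
  by move=> u0 u1; apply: HM; rewrite mulrC -Rc_scale; exact: convex_segment.
move=> /(_ seg) H; rewrite ler_pdivlMr//.
have : `|f^`().[z] : C R| * (diameter K / 4) <= 18 * m%:R ^+ 3 * M.
  by apply: le_trans H; apply: ler_wpM2l.
lra.
Qed.

Lemma poly_lipschitz (f : {poly C R}) : exists M : R,
  forall z w, K z -> K w -> `|f.[z] - f.[w] : C R| <= M * `|z - w|.
Proof.
have [cK _ _] := KK; have [D _ HD] := compact_norm_bounded cK.
have [M HM] := poly_bounded f^`() D.
exists M => z w Kz Kw; apply: poly_increment_le => u u0 u1.
by apply: HM; apply: HD; rewrite mulrC -Rc_scale; exact: convex_segment.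
Qed.

End diameter.

Section boundary_values.
Variables (R : realType) (K : set (C R)) (L : R) (g : R -> C R).
Hypotheses (KK : compact_convex_domain K)
  (Kg : arclength_parametrization K L g).

Let L_gt0 : 0 < L. Proof. by case: Kg. Qed.

Lemma arclength_dist s t : `|g t - g s| <= `|t - s|.
Proof.
have [st|/ltW ts] := leP s t.
  by rewrite (ger0_norm (_ : 0 <= t - s)) ?subr_ge0// (arclength_lipschitz Kg).
rewrite distrC [leRHS]distrC (ger0_norm (_ : 0 <= s - t)) ?subr_ge0//.
exact: (arclength_lipschitz Kg).
Qed.

Lemma continuous_boundary_norm (f : {poly C R}) :
  continuous (fun t => `|f.[g t] : C R|).
Proof.
have [M HM] := poly_lipschitz KK f.
have h : {within setT, continuous (fun t => `|f.[g t] : C R|)}.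
  apply: (@lipschitz_within_continuous _ R^o _ _ `|M|) => x y _ _.
  apply: le_trans (ler_dist_dist _ _) _.
  apply: le_trans (HM _ _ (curve_in KK Kg x) (curve_in KK Kg y)) _.
  apply: le_trans (ler_wpM2r _ (ler_norm M)) _ => //.
  by rewrite ler_wpM2l// arclength_dist.
move=> x; apply/cvgrPdist_le => e e0.
have /subspace_continuousP/(_ x I)/cvgrPdist_le/(_ e e0) := h.
by rewrite near_withinE; apply: filterS => y; exact.
Qed.

(** The maximum principle, by [maximum_principle_disc] in the largest disc of
    the domain around a point of maximum. *)
Lemma maximum_on_boundary (f : {poly C R}) : exists t, [/\ 0 <= t, t <= L &
  forall z, K z -> `|f.[z] : C R| <= `|f.[g t] : C R|].
Proof.
have [M HM] := poly_lipschitz KK f.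
have [cK _ [x0 /interior_subset Kx0]] := KK.
have cf : {within K, continuous (fun z => `|f.[z] : C R|)}.
  apply: (@lipschitz_within_continuous _ _ _ _ M) => x y Kx Ky.
  exact: le_trans (ler_dist_dist _ _) (HM _ _ Kx Ky).
have K0 : K !=set0 by exists x0.
have [z0] := compact_EVT_max K0 cK cf.
rewrite inE => Kz0 Hz0.
have cd : {within `[0, L], continuous (fun t => `|g t - z0|)}.
  apply: (@lipschitz_within_continuous _ R^o _ _ 1) => x y _ _.
  apply: le_trans (ler_dist_dist _ _) _; rewrite mul1r.
  have -> : g x - z0 - (g y - z0) = g x - g y by ring.
  exact: arclength_dist.
have [t0] := EVT_min (ltW L_gt0) cd.
rewrite in_itv/= => /andP[t00 t0L] Ht0.
exists t0; split => // z Kz.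
apply: (@le_trans _ _ `|f.[z0] : C R|); first by apply: Hz0; rewrite inE.
have := @maximum_principle_disc _ f z0 (g t0 - z0).
rewrite subrKC; apply => w wz.
apply: Hz0; rewrite inE.
have [->//|wz0] := eqVneq w z0.
have e0 : w - z0 != 0 by rewrite subr_eq0.
have [s s0 Bs] := ray_boundary KK Kz0 e0.
have [u /andP[u0 uL] gu] := boundary_curve Kg 0 Bs.
have : `|g t0 - z0| <= `|g u - z0|.
  by apply: Ht0; rewrite in_itv/= u0 ltW// -[L]add0r.
rewrite gu addrAC subrr add0r Rcomplex_normrZ (ger0_norm s0) => h.
have s1 : 1 <= s.
  rewrite -(@ler_pM2r _ `|w - z0|) ?normr_gt0// mul1r.
  exact: le_trans h.
have := convex_segment (u := s^-1) KK Kz0 (boundary_sub KK Bs).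
have -> : z0 + s^-1 *: (z0 + s *: (w - z0) - z0) = w.
  rewrite [z0 + s *: _]addrC addrK scalerA mulVf ?scale1r ?subrKC//.
  by rewrite gt_eqF// (lt_le_trans _ s1).
by apply; rewrite ?invr_ge0// invf_le1// (lt_le_trans _ s1).
Qed.

(** Lower bound for the integral means, over the boundary, of a polynomial of
    degree [m]: by the Markov inequality its modulus is at least half of its
    maximum on an arc of length of order [(m + 1) ^ -3]. *)
Lemma boundary_integral_ge (f : {poly C R}) (m : nat) (q Delta : R) :
  0 < diameter K -> 1 <= q -> 0 < Delta -> is_transfinite_diameter K Delta ->
  size f = m.+1 ->
  Num.min (L / 2) (diameter K / (144%:R * m.+1%:R ^+ 3)) *
    (`|lead_coef f : C R| * Delta ^+ m / 2) `^ q <=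
  \int[lebesgue_measure]_(t in `[0, L]) (`|f.[g t] : C R| `^ q).
Proof.
move=> d0 q1 Delta0 KDelta sf; have [cK _ [x0 /interior_subset Kx0]] := KK.
have [D D1 HD] := compact_norm_bounded cK.
have [t0 [t00 t0L Ht0]] := maximum_on_boundary f.
set M := `|f.[g t0] : C R| in Ht0 *.
have f0 : f != 0 by rewrite -size_poly_eq0 sf.
have lc0 : lead_coef f != 0 by rewrite lead_coef_eq0.
have nlc : 0 < `|lead_coef f : C R| by rewrite normr_gt0.
have MD : `|lead_coef f : C R| * Delta ^+ m <= M.
  rewrite mulrC -ler_pdivlMr//.
  pose h := (lead_coef f)^-1 *: f.
  apply: (@transfinite_diameter_le _ K Delta D h m) => //; first by exists x0.
  - by rewrite monicE lead_coefZ mulVf.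
  - by rewrite size_scale ?invr_eq0.
  move=> x Kx; rewrite hornerZ normRcM normRcV mulrC ler_wpM2r ?invr_ge0//.
  exact: Ht0.
have M0 : 0 < M by apply: lt_le_trans MD; rewrite mulr_gt0// exprn_gt0.
set d := diameter K in d0 *; set n := m.+1.
pose S := 72%:R * n%:R ^+ 3 * M / d.
have n0 : 0 < n%:R :> R by rewrite ltr0n.
have S0 : 0 <= S.
  apply: divr_ge0; last exact: ltW.
  apply: mulr_ge0; last exact: ltW.
  by rewrite mulr_ge0// exprn_ge0.
have sfn : (size f <= n.+1)%N by rewrite sf.
have lip t : `|f.[g t] - f.[g t0] : C R| <= S * `|t - t0|.
  apply: (@le_trans _ _ (S * `|g t - g t0|)).
    apply: poly_increment_le => u u0 u1; apply: (markov_domain KK d0 sfn Ht0).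
    rewrite mulrC -Rc_scale.
    by apply: convex_segment => //; exact: (curve_in KK Kg).
  by apply: ler_wpM2l => //; exact: arclength_dist.
set tau := Num.min _ _.
have tau0 : 0 < tau.
  by rewrite lt_min !divr_gt0// mulr_gt0// exprn_gt0.
have tauL : tau <= L / 2 by rewrite ge_min lexx.
have Stau : S * tau <= M / 2.
  apply: (@le_trans _ _ (S * (d / (144%:R * n%:R ^+ 3)))).
    by apply: ler_wpM2l => //; rewrite ge_min lexx orbT.
  rewrite le_eqVlt; apply/orP; left; apply/eqP; rewrite /S; field.
  by rewrite (gt_eqF d0) (gt_eqF n0).
have big t : `|t - t0| <= tau ->
    `|lead_coef f : C R| * Delta ^+ m / 2 <= `|f.[g t] : C R|.
  move=> tt; apply: (@le_trans _ _ (M / 2)); first by rewrite ler_wpM2r.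
  have h1 : S * `|t - t0| <= M / 2.
    by apply: le_trans Stau; exact: ler_wpM2l.
  have h2 : M <= `|f.[g t] : C R| + `|f.[g t] - f.[g t0] : C R|.
    by have := ler_normB (f.[g t] : C R) (f.[g t] - f.[g t0]); rewrite subKr.
  have h3 := le_trans (lip t) h1.
  move: h2 h3; move: (`|f.[g t] : C R|) (`|f.[g t] - _ : C R|) => x y.
  clear -M; lra.
have m0 : 0 <= `|lead_coef f : C R| * Delta ^+ m / 2.
  by rewrite divr_ge0// mulr_ge0// exprn_ge0// ltW.
have cf : continuous (fun t => `|f.[g t] : C R|).
  exact: continuous_boundary_norm.
have f_ge0 t : 0 <= `|f.[g t] : C R| by [].
(* the arc starts or ends at the point of maximum, so as to stay within one
   period *)
have [h|h] := leP t0 (L / 2).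
  have := @integral_powR_ge _ L q L_gt0 q1 _ t0 (t0 + tau) _ cf f_ge0 m0 t00.
  have -> : t0 + tau - t0 = tau by ring.
  by apply; [lra|lra|move=> t h1 h2; apply: big; rewrite ger0_norm; lra].
have := @integral_powR_ge _ L q L_gt0 q1 _ (t0 - tau) t0 _ cf f_ge0 m0.
have -> : t0 - (t0 - tau) = tau by ring.
apply; [lra|lra|lra|move=> t h1 h2; apply: big; rewrite ler0_norm; lra].
Qed.

End boundary_values.

(** * The inequality *)

Lemma exists_exprn_ge (R : realType) (x y : R) : 1 < y ->
  exists2 m : nat, (0 < m)%N & x <= y ^+ m.
Proof.
move=> y1; have y0 : 0 < y - 1 by rewrite subr_gt0.
have bern (m : nat) : m%:R * (y - 1) <= y ^+ m.
  elim: m => [|m IH]; first by rewrite mul0r.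
  rewrite -natr1 exprS; have := exprn_ege1 m (ltW y1); nra.
exists (Num.truncn `|x / (y - 1)|).+1 => //; apply: le_trans (bern _).
rewrite -ler_pdivrMr//; apply: le_trans (ler_norm _) _.
exact/ltW/truncnS_gt.
Qed.

Lemma size_deriv_Rc (R : realType) (p : {poly C R}) (n : nat) :
  size p = n.+2 -> size p^`() = n.+1 /\ lead_coef p^`() = n.+1%:R * lead_coef p.
Proof.
move=> sp.
have c0 : p^`()`_n = n.+1%:R * lead_coef p.
  by rewrite coef_deriv lead_coefE sp mulr_natl.
have nz : p^`()`_n != 0.
  by rewrite c0 mulf_neq0// ?natRc_eq0// lead_coef_eq0 -size_poly_eq0 sp.
have s1 : size p^`() = n.+1.
  apply/eqP; rewrite eqn_leq; apply/andP; split.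
    have p0 : p != 0 by rewrite -size_poly_eq0 sp.
    by have := lt_size_deriv p0; rewrite sp ltnS.
  by rewrite ltnNge; apply: contra nz => h; rewrite nth_default.
by split=> //; rewrite lead_coefE s1.
Qed.

Lemma powR_sum_le (R : realType) (q x y z : R) : 1 <= q -> 0 <= x -> x <= z ->
  0 <= y -> y <= z -> x `^ q + y `^ q <= (2 * z) `^ q.
Proof.
move=> q1 x0 xz y0 yz.
have q0 : 0 <= q by apply: le_trans q1.
have z0 : 0 <= z by apply: le_trans xz.
have hx : x `^ q <= z `^ q by rewrite ge0_ler_powR ?nnegrE.
have hy : y `^ q <= z `^ q by rewrite ge0_ler_powR ?nnegrE.
apply: (le_trans (lerD hx hy)); rewrite -mulr2n -[leLHS]mulr_natl powRM//.
by rewrite ler_wpM2r ?powR_ge0// powR_ge_self// ler1n.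
Qed.

(** An alternative between closed conditions that holds off a null set holds
    everywhere. *)
Lemma alternative_of_ae (R : realType) (h1 h2 : R -> R) (s B : R) (N : set R) :
  (@lebesgue_measure R).-negligible N -> continuous h1 -> continuous h2 ->
  (forall t, ~ N t -> h1 t <= s * h2 t \/ h1 t <= B) ->
  forall t, h1 t <= s * h2 t \/ h1 t <= B.
Proof.
move=> negN c1 c2 H t.
have [h|h] := leP (h1 t) (s * h2 t); first by left.
have [h'|h'] := leP (h1 t) B; first by right.
exfalso.
have cB : (fun x => h1 x - s * h2 x) x @[x --> t] --> h1 t - s * h2 t.
  by apply: cvgB; [exact: c1|apply: cvgMr; exact: c2].
have n1 : \forall x \near t, 0 < h1 x - s * h2 x.
  by apply: (cvgr_gt _ cB); rewrite subr_gt0.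
have n2 : \forall x \near t, B < h1 x by exact: (cvgr_gt _ (c1 t)).
have n3 : nbhs t [set x | 0 < h1 x - s * h2 x /\ B < h1 x] by exact: filterI.
have /nbhs_ballP[r /= r0 Hr] := n3.
have tr : t - r < t + r by lra.
have [v /andP[v1 v2] Nv] := negligible_complement_dense negN tr.
have [] : 0 < h1 v - s * h2 v /\ B < h1 v.
  by apply: Hr; rewrite /ball/= ltr_distlC; apply/andP; split; lra.
by case: (H v Nv); lra.
Qed.

Theorem theorem1 (R : realType) (k : nat) (d Delta kappa xi delta : R) :
  (0 < k)%N -> 0 < d -> 0 < Delta -> 0 < kappa -> 0 < xi -> 0 < delta ->
  Delta <= d / 2 -> delta <= Delta / 2 -> xi <= pi / 2 ->
  exists2 cK : R, 0 < cK &
    forall (K : set (Rcomplex R)) (L : R) (gamma : R -> Rcomplex R)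
           (alpha : R -> R),
      compact_convex_domain K ->
      arclength_parametrization K L gamma ->
      tangent_angle L gamma alpha ->
      E_domain k d Delta kappa xi delta K L gamma alpha ->
      forall (q : R) (n : nat) (p : {poly Rcomplex R}),
        1 <= q -> (0 < n)%N -> polys_zeros_in n K p ->
        cK * n%:R * boundary_norm L gamma q (fun z => p.[z])
          <= boundary_norm L gamma q (fun z => (deriv p).[z]).
Proof.
move=> _ d0 D0 ka0 xi0 de0 _ deD _.
have co1 : 0 < cos 1 :> R by exact: cos1_gt0.
pose r := Delta - delta / 2; pose rho := Delta - delta / 4.
have r0 : 0 < r by rewrite /r; lra.
have rrho : r < rho by rewrite /r /rho; lra.
have rhoD : rho < Delta by rewrite /rho; lra.
have rr1 : 1 < rho / r by rewrite ltr_pdivlMr// mul1r.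
(* [1 / m] is the proportion of distant zeros that makes the derivative large *)
have [m m0 Hm] := exists_exprn_ge (d / r) rr1.
pose eta := short_constant delta xi.
have eta0 : 0 < eta by exact: short_constant_gt0.
pose c1 := curved_constant d kappa xi.
have c10 : 0 < c1 by exact: curved_constant_gt0.
pose c := Num.min c1 (eta / (m%:R * d ^+ 2)).
have c0 : 0 < c by rewrite lt_min c10 divr_gt0// mulr_gt0 ?ltr0n// exprn_gt0.
have th0 : 0 <= rho / Delta by rewrite divr_ge0 ?ltW// (lt_trans r0).
have th1 : rho / Delta < 1 by rewrite ltr_pdivrMr// mul1r.
have [B B0 HB] := cube_geometric_bounded th0 th1.
(* [e * d] bounds the perimeter, and [T * n ^ 3] the ratio of the perimeter to
   the length of the arc on which the derivative is large *)
pose e : R := 8 / cos 1.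
have e0 : 0 < e by rewrite divr_gt0.
pose T := 144 * e + 2.
have T2 : 2 <= T by rewrite /T; lra.
have T0 : 0 < T by exact: lt_le_trans T2.
pose G := 2 * T * Delta * B.
have G0 : 0 < G by rewrite /G !mulr_gt0.
pose H := 2 * Num.max c^-1 G.
have H0 : 0 < H by rewrite mulr_gt0// lt_max invr_gt0 c0.
exists H^-1; first by rewrite invr_gt0.
move=> K L g alpha KK Kg ga KE q n p q1 n0 Kp.
have L0 : 0 < L by case: Kg.
have q0 : 0 < q by apply: lt_le_trans q1.
have [hd KD _] := KE.
have Kd z w : K z -> K w -> `|z - w| <= d.
  by move=> Kz Kw; rewrite -hd; exact: le_diameter.
case: n n0 Kp => // n _ Kp.
have sp : size p = n.+2 by case: Kp.
have [sf lf] := size_deriv_Rc sp.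
set f := p^`() in sf lf *; set a := lead_coef p in lf *.
have a0 : 0 < `|a : C R|.
  by rewrite normr_gt0 lead_coef_eq0 -size_poly_eq0 sp.
pose N1 : R := n.+1%:R; have N10 : 0 < N1 by rewrite ltr0n.
have N11 : 1 <= N1 by rewrite ler1n.
(* on the boundary, |p| is at most [s * |p'|] or at most [Bn] *)
pose s := (c * N1)^-1; have s0 : 0 < s by rewrite invr_gt0 mulr_gt0.
pose Bn := `|a : C R| * rho ^+ n.+1.
have rho0 : 0 < rho by apply: lt_trans rrho.
have Bn0 : 0 < Bn by rewrite mulr_gt0// exprn_gt0.
pose h1 t := `|p.[g t] : C R|; pose h2 t := `|f.[g t] : C R|.
have ch1 : continuous h1 by exact: (continuous_boundary_norm KK Kg).
have ch2 : continuous h2 by exact: (continuous_boundary_norm KK Kg).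
have h10 t : 0 <= h1 t by exact: normr_ge0.
have h20 t : 0 <= h2 t by exact: normr_ge0.
have alt : forall t, h1 t <= s * h2 t \/ h1 t <= Bn.
  have [N negN HN] := E_domain_seen_from d0 ka0 xi0 de0 KK Kg ga KE Kd.
  apply: (alternative_of_ae negN ch1 ch2) => t Nt.
  have [th Hth] := HN t Nt.
  have Kgt z : K z -> `|g t - z| <= d.
    by move=> Kz; apply: Kd => //; exact: (curve_in KK Kg).
  have cc1 : c <= c1 by rewrite ge_min lexx.
  have ce : c <= eta / (m%:R * d ^+ 2) by rewrite ge_min lexx orbT.
  have [hh|hh] := derivative_large_or_small Hth Kgt r0 eta0 d0 m0 rrho Hm
    (ltW c0) cc1 ce Kp; last by right.
  left; rewrite /s ler_pdivlMl ?mulr_gt0//.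
pose I1 := \int[lebesgue_measure]_(t in `[0, L]) (h1 t `^ q).
pose J1 := \int[lebesgue_measure]_(t in `[0, L]) (h2 t `^ q).
have I1le : I1 <= s `^ q * J1 + L * Bn `^ q.
  exact: (integral_powR_le L0 q1 ch1 ch2 h10 h20 (ltW s0) (ltW Bn0) alt).
have I10 : 0 <= I1 by apply: Rintegral_ge0 => t _; exact: powR_ge0.
have J10 : 0 <= J1 by apply: Rintegral_ge0 => t _; exact: powR_ge0.
have dK0 : 0 < diameter K by rewrite hd.
pose P := `|lead_coef f : C R| * Delta ^+ n / 2.
pose tau := Num.min (L / 2) (d / (144%:R * N1 ^+ 3)).
have Jge : tau * P `^ q <= J1.
  have := boundary_integral_ge KK Kg dK0 q1 D0 KD sf.
  by rewrite hd.
have P0 : 0 <= P.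
  by rewrite divr_ge0// mulr_ge0// exprn_ge0// ltW.
pose X := 2 * Delta * (rho / Delta) ^+ n.+1 / N1.
have X0 : 0 <= X.
  by rewrite divr_ge0 ?(ltW N10)// mulr_ge0 ?exprn_ge0// mulr_ge0// ltW.
have BX : Bn = X * P.
  rewrite /Bn /X /P lf normRcM normRc_nat -/N1 expr_div_n exprS.
  rewrite [Delta ^+ n.+1]exprS.
  have Dn0 : Delta ^+ n != 0 by rewrite expf_neq0// gt_eqF.
  by move: (Delta ^+ n) (rho ^+ n) Dn0 => x y x0; field; rewrite x0 !gt_eqF.
have N30 : 1 <= N1 ^+ 3 by rewrite exprn_ege1.
have Ltau : L <= T * N1 ^+ 3 * tau.
  have per := perimeter_le KK Kg ga Kd.
  have TN : 2 <= T * N1 ^+ 3 by rewrite -[2]mulr1 ler_pM.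
  have TN0 : 0 < T * N1 ^+ 3 by exact: lt_le_trans TN.
  rewrite -ler_pdivrMl//.
  rewrite le_min; apply/andP; split; rewrite ler_pdivrMl//.
    by rewrite mulrCA -[leLHS]mulr1 ler_wpM2l ?(ltW L0)// ler_pdivlMr// mul1r.
  have -> : T * N1 ^+ 3 * (d / (144 * N1 ^+ 3)) = e * d + d / 72.
    by rewrite /T; field; rewrite gt_eqF.
  apply: (@le_trans _ _ (e * d)); first by rewrite /e mulrAC ler_pdivlMr.
  by rewrite lerDl divr_ge0// ltW.
have TN1 : 1 <= T * N1 ^+ 3.
  by rewrite -[1]mulr1 ler_pM// (le_trans _ T2)// ler1n.
have TN0 : 0 <= T * N1 ^+ 3 by exact: le_trans TN1.
have Gn : T * N1 ^+ 3 * X <= G / N1.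
  rewrite /X /G; have := HB n.+1; rewrite -/N1.
  move: ((rho / Delta) ^+ n.+1) => y hB.
  have -> : T * N1 ^+ 3 * (2 * Delta * y / N1) =
      2 * T * Delta * (N1 ^+ 3 * y) / N1.
    by field; rewrite gt_eqF.
  apply: ler_wpM2r; first by rewrite invr_ge0 ltW.
  by apply: ler_wpM2l => //; rewrite !mulr_ge0 ?(ltW D0) ?(ltW T0).
(* the points of the second kind are absorbed in the norm of the derivative *)
have LB : L * Bn `^ q <= (G / N1) `^ q * J1.
  rewrite BX powRM//.
  have hx : 0 <= X `^ q * P `^ q by rewrite mulr_ge0// powR_ge0.
  apply: (le_trans (ler_wpM2r hx Ltau)).
  have -> : T * N1 ^+ 3 * tau * (X `^ q * P `^ q) =
    (T * N1 ^+ 3) * X `^ q * (tau * P `^ q) by ring.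
  apply: ler_pM => //.
  - by rewrite mulr_ge0// powR_ge0.
  - rewrite mulr_ge0 ?powR_ge0// le_min divr_ge0 ?(ltW L0)//=.
    by rewrite divr_ge0 ?(ltW d0)// mulr_ge0// exprn_ge0// ltW.
  apply: (@le_trans _ _ ((T * N1 ^+ 3 * X) `^ q)).
    by rewrite powRM// ler_wpM2r ?powR_ge0// powR_ge_self.
  rewrite ge0_ler_powR ?nnegrE ?(ltW q0)//; first exact: mulr_ge0.
  by rewrite divr_ge0// ltW.
have Hs : s `^ q + (G / N1) `^ q <= (H / N1) `^ q.
  have -> : H / N1 = 2 * (Num.max c^-1 G / N1) by rewrite /H mulrA.
  apply: powR_sum_le => //; first exact: ltW.
  - by rewrite /s invfM ler_wpM2r ?invr_ge0 ?(ltW N10)// le_max lexx.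
  - by rewrite divr_ge0// ltW.
  - by rewrite ler_wpM2r ?invr_ge0 ?(ltW N10)// le_max lexx orbT.
have IJ : I1 <= (H / N1) `^ q * J1.
  apply: (le_trans I1le); apply: le_trans (ler_wpM2r J10 Hs).
  by rewrite mulrDl lerD2l.
have HN0 : 0 <= H / N1 by rewrite divr_ge0// ltW.
have := powR_root_le q1 I10 J10 HN0 IJ.
rewrite /boundary_norm -/I1 -/J1 => fin.
have : H^-1 * N1 * I1 `^ q^-1 <= H^-1 * N1 * (H / N1 * J1 `^ q^-1).
  by rewrite ler_wpM2l// mulr_ge0 ?invr_ge0 ?(ltW H0) ?(ltW N10).
have -> : H^-1 * N1 * (H / N1 * J1 `^ q^-1) = J1 `^ q^-1.
  by field; rewrite !gt_eqF.
by [].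
Qed.
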